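(* Let $n\ge 1$ and let $I$ and $J$ be two compositions of $n$. Then $$\sum_{\substack{u\in\mathfrak{SF}_n\\ \mathrm{DC}(u)=I\\ \mathrm{LC}(u)=J}} q^{\mathrm{inv}(u)-\mathrm{maj}(\overline{J})}\;=\;\sum_{\substack{\sigma\in\mathfrak{S}_n\\ \mathrm{Rec}(\sigma)=I\\ \mathrm{GC}(\sigma)=J}} q^{\mathrm{tot}(\sigma)}.$$
   Context: Compositions. A composition of $n$ is a sequence $I=(i_1,\dots,i_r)$ of positive integers with sum $n$. Its descent set is $\{i_1,i_1+i_2,\dots,i_1+\cdots+i_{r-1}\}\subseteq\{1,\dots,n-1\}$; a composition of $n$ is determined by its descent set, and every subset of $\{1,\dots,n-1\}$ occurs. The major index $\mathrm{maj}(I)$ is the sum of the elements of the descent set of $I$. The mirror image is $\overline{I}=(i_r,\dots,i_1)$. Permutations. $\mathfrak{S}_n$ is the set of permutations $\sigma=\sigma_1\cdots\sigma_n$ of $\{1,\dots,n\}$. - A recoil of $\sigma$ is a value $i\in\{1,\dots,n-1\}$ such that $i+1$ is to the left of $i$ in $\sigma$; $\mathrm{Rec}(\sigma)$ is the composition of $n$ whose descent set is the set of recoils of $\sigma$. - $\mathrm{GDes}(\sigma)=\{\sigma_i \mid 1\le i\le n-1,\ \sigma_i>\sigma_{i+1}\}$ and $\mathrm{GC}(\sigma)$ is the composition of $n$ whose descent set is $\{d-1\mid d\in\mathrm{GDes}(\sigma)\}$. - $\mathrm{tot}(\sigma)$ is the number of pairs $(i,j)$ with $1\le i$, $i+1<j\le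 n$ and $\sigma_{i+1}<\sigma_j<\sigma_i$ (the $31\text{-}2$ patterns). Subexcedent functions. $\mathfrak{SF}_n$ is the set of words $u=u_1\cdots u_n$ of nonnegative integers with $u_i\le n-i$ for all $i$. - $\mathrm{inv}(u)=\sum_i u_i$. - $\mathrm{DC}(u)$ is the composition of $n$ whose descent set is $\{i\in\{1,\dots,n-1\}\mid u_i>u_{i+1}\}$. - $\mathrm{LC}(u)$ is defined as follows: start with $S=\emptyset$ and read $u$ from right to left; at each step, if the entry $k$ read is strictly greater than $|S|$, add to $S$ the $(k-|S|)$-th smallest element of $\{1,\dots,n\}\setminus S$ (otherwise leave $S$ unchanged). The final $S$ is the descent set of a composition $C$ of $n$, and $\mathrm{LC}(u)=\overline{C}$. *)

(* Defs.v *)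
From mathcomp Require Import all_boot all_order all_fingroup all_algebra.

Set Implicit Arguments.
Unset Strict Implicit.
Unset Printing Implicit Defensive.

Definition is_composition (n : nat) (I : seq nat) : bool :=
  all (fun i => 0 < i) I && (sumn I == n).

Definition descent_set (I : seq nat) : seq nat :=
  [seq sumn (take k I) | k <- iota 1 (size I).-1].

Definition maj (I : seq nat) : nat := sumn (descent_set I).

(* The composition of n (for 0 < n) with descent set D, where D is a subset of
   {1, ..., n-1} given by a list in any order: its parts are the gaps between
   0, the elements of D in increasing order, and n.  Lemmas composition_of_ok,
   descent_set_of and composition_ofK below justify the definition. *)
Definition composition_of (n : nat) (D : seq nat) : seq nat :=
  pairmap (fun a b => b - a) 0 (rcons [seq i <- iota 1 n.-1 | i \in D] n).

(* Words are lists whose letters are numbered from 1. *)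
Definition letter (w : seq nat) (i : nat) : nat := nth 0 w i.-1.

(* The word of a permutation, with letters in {1, ..., n}. *)
Definition perm_word (n : nat) (s : 'S_n) : seq nat :=
  [seq (s i).+1 | i <- enum 'I_n].

Definition recoils (n : nat) (s : 'S_n) : seq nat :=
  [seq i <- iota 1 n.-1 | index i.+1 (perm_word s) < index i (perm_word s)].

Definition Rec (n : nat) (s : 'S_n) : seq nat := composition_of n (recoils s).

Definition GDes (n : nat) (s : 'S_n) : seq nat :=
  let w := perm_word s in
  [seq letter w i | i <- iota 1 n.-1 & letter w i.+1 < letter w i].

Definition GC (n : nat) (s : 'S_n) : seq nat :=
  composition_of n [seq d.-1 | d <- GDes s].

(* The elements of 'I_n.+1 are 0, ..., n, so that p ranges over the pairs
   (i, j) with 1 <= i and i + 1 < j <= n. *)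
Definition tot (n : nat) (s : 'S_n) : nat :=
  let w := perm_word s in
  #|[set p : 'I_n.+1 * 'I_n.+1 |
      [&& 0 < p.1, p.1.+1 < p.2,
          letter w p.1.+1 < letter w p.2 & letter w p.2 < letter w p.1]]|.

(* Letters of a subexcedent word are at most n - 1, hence lie in 'I_n; the
   index i : 'I_n stands for the position i + 1. *)
Definition subexcedent (n : nat) (u : n.-tuple 'I_n) : bool :=
  [forall i : 'I_n, tnth u i <= n - i.+1].

Definition sf_word (n : nat) (u : n.-tuple 'I_n) : seq nat :=
  [seq val k | k <- u].

Definition inv_sf (n : nat) (u : n.-tuple 'I_n) : nat := sumn (sf_word u).

Definition DC (n : nat) (u : n.-tuple 'I_n) : seq nat :=
  let w := sf_word u in
  composition_of n [seq i <- iota 1 n.-1 | letter w i.+1 < letter w i].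

(* S is a list without repetition, so that size S is the cardinality of the
   set it represents. *)
Definition LC_step (n k : nat) (S : seq nat) : seq nat :=
  if size S < k
  then letter [seq x <- iota 1 n | x \notin S] (k - size S) :: S
  else S.

(* foldr processes the letters from right to left. *)
Definition LC_set (n : nat) (u : n.-tuple 'I_n) : seq nat :=
  foldr (LC_step n) [::] (sf_word u).

Definition LC (n : nat) (u : n.-tuple 'I_n) : seq nat :=
  rev (composition_of n (LC_set u)).

(* The indeterminate q, in the fraction field of Z[q]: the exponents in the
   identity are differences, so that they are taken in int. *)
Definition q : {fraction {poly int}} := tofrac ('X : {poly int})%R.

Lemma sumn_gaps a s : path leq a s ->
  sumn (pairmap (fun a b => b - a) a s) = last a s - a.
Proof.
elim: s a => [|b s IHs] a /=; first by rewrite subnn.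
case/andP=> le_ab pbs; rewrite IHs // addnC addnBA // subnK //.
by elim: s b pbs {IHs le_ab} => //= c s IHs b /andP[/leq_trans h /IHs]; apply: h.
Qed.

Lemma path_filter_rcons n (P : pred nat) : 0 < n ->
  path ltn 0 (rcons [seq i <- iota 1 n.-1 | P i] n).
Proof.
case: n => // n _; rewrite /= rcons_path; apply/andP; split.
  rewrite path_min_sorted; first exact: sorted_filter ltn_trans _ _ (iota_ltn_sorted _ _).
  by apply/allP => x; rewrite mem_filter mem_iota => /and3P[_ ? _].
have := mem_last 0 [seq i <- iota 1 n | P i].
by rewrite inE mem_filter mem_iota => /orP[/eqP-> | /and3P[_ _]].
Qed.

Lemma composition_of_ok n D : 0 < n -> is_composition n (composition_of n D).
Proof.
move=> n_gt0; have pD := path_filter_rcons (mem D) n_gt0.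
apply/andP; split; last first.
  rewrite /composition_of sumn_gaps ?last_rcons ?subn0 //.
  exact: sub_path (fun a b => @ltnW a b) _ _ pD.
have gapsP a s : path ltn a s ->
    all (fun i => 0 < i) (pairmap (fun a b => b - a) a s).
  elim: s a => //= b s IHs a /andP[lt_ab /IHs->].
  by rewrite subn_gt0 lt_ab.
exact: gapsP.
Qed.

Lemma sumn_take_gaps a s k : path leq a s -> k < size s ->
  a + sumn (take k.+1 (pairmap (fun a b => b - a) a s)) = nth 0 s k.
Proof.
elim: s a k => //= b s IHs a [|k] /andP[le_ab pbs] lt_k.
  by rewrite take0 /= addn0 subnKC.
by rewrite addnA subnKC // IHs.
Qed.

Lemma descent_set_of n D : 0 < n ->
  descent_set (composition_of n D) = [seq i <- iota 1 n.-1 | i \in D].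
Proof.
move=> n_gt0; have pD := path_filter_rcons (mem D) n_gt0.
have {}pD := sub_path (fun a b => @ltnW a b) pD.
rewrite /descent_set /composition_of size_pairmap size_rcons /=.
set s := filter _ _ in pD *; rewrite (iotaDl 1 0) -map_comp.
apply: (@eq_from_nth _ 0); first by rewrite size_map size_iota.
move=> k; rewrite size_map size_iota => lt_k.
rewrite (nth_map 0) ?size_iota // nth_iota //= add0n add1n.
have /= := @sumn_take_gaps 0 (rcons s n) k pD; rewrite add0n size_rcons => ->; last exact: ltnW.
by rewrite nth_rcons lt_k.
Qed.

Lemma composition_ofK n I : 0 < n -> is_composition n I ->
  composition_of n (descent_set I) = I.
Proof.
move=> n_gt0 /andP[I_gt0 /eqP sI].
have gapsE a s : all (fun i => 0 < i) s ->
    pairmap (fun a b => b - a) a (scanl addn a s) = s /\ path ltn a (scanl addn a s).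
  elim: s a => //= b s IHs a /andP[b_gt0 /(IHs (a + b))[-> ->]].
  by rewrite addKn -[X in X < _]addn0 ltn_add2l b_gt0.
have [gE pE] := gapsE 0 _ I_gt0.
rewrite -[RHS]gE /composition_of; congr pairmap.
have scE a s : scanl addn a s = [seq a + sumn (take k s) | k <- iota 1 (size s)].
  elim: s a => //= b s IHs a; rewrite take0 /= addn0 IHs; congr (_ :: _).
  by rewrite (iotaDl 1 1) -map_comp; apply: eq_map => k; rewrite /= addnA.
have szI : 0 < size I by case: (I) sI n_gt0 => //= <-.
have scI : scanl addn 0 I = rcons (descent_set I) n.
  have iotaS m : 0 < m -> iota 1 m = rcons (iota 1 m.-1) m.
    by case: m => // m _; rewrite -cats1 -(iotaD 1 m 1) addn1.
  by rewrite scE iotaS // map_rcons take_size add0n sI.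
rewrite scI; congr rcons; rewrite scI in pE.
have pD : sorted ltn (descent_set I).
  by move: pE; rewrite rcons_path => /andP[/path_sorted].
apply: (irr_sorted_eq ltn_trans ltnn) => //.
  exact: sorted_filter ltn_trans _ _ (iota_ltn_sorted _ _).
move=> x; rewrite mem_filter mem_iota add1n prednK //; case: (boolP (x \in _)) => //= xD.
have := order_path_min ltn_trans pE; rewrite all_rcons => /andP[_ /allP/(_ _ xD) ->].
move: pE => /path_sorted; rewrite -(revK (rcons _ _)) rev_rcons rev_sorted /=.
move/(order_path_min (fun a b c h1 h2 => ltn_trans h2 h1))/allP; apply.
by rewrite mem_rev.
Qed.

(* Main.v *)
Require Import Defs.
From mathcomp Require Import all_boot all_order all_fingroup all_algebra.
From mathcomp Require Import ring zify.

(* Both sides satisfy one recursion.  Read [I] through its runs: by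
   inclusion-exclusion it is enough to impose, for some of the [i], that
   [u_i <= u_(i+1)], resp. that [i] is to the left of [i+1] in [sigma], and
   nothing for the other [i].

   Words: a run of constrained letters is read from right to left as a weakly
   decreasing sequence; it first inserts a decreasing sequence of elements into
   [S], and its remaining letters are at most [|S|], hence are counted by a
   complete symmetric function of [1, q, ..., q^|S|].

   Permutations: insert the values [n, ..., 1] one by one.  The values [>= c]
   form [h] blocks closed on the right by a smaller value, and a last block;
   the number of patterns 31-2 with "2" equal to [c] is the number [g] of blocks
   to the left of the block of [c].  On vectors indexed by [h], with
   [U e_h = e_(h+1)], a run of [p] values of which [d] are descent tops acts by
   [U^d Y_p], and [Y_p U = Y_(p-1) U + q^p U Y_p + q^(p-1) Y_(p-1)].  The [Y_p]
   are simultaneously diagonal in the basis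
   [v_h = (U + q^-h) ... (U + q^-1) e_0], with eigenvalues
   [h_p(1, q, ..., q^h)].  So the leftmost [Y_p] can be commuted through all the
   [U]'s and all the other [Y]'s, and this yields the recursion of the words. *)

Set Implicit Arguments.
Unset Strict Implicit.
Unset Printing Implicit Defensive.

Import GRing.Theory.

(** * Complete symmetric functions and the operators [U] and [Y_p] *)

Section Algebra.

Local Open Scope ring_scope.

Variables (F : fieldType) (x : F).

(* The complete symmetric function [h_p(1, x, ..., x^k)]. *)
Fixpoint hsym (p k : nat) : F :=
  match p with
  | 0 => 1
  | p'.+1 => (fix aux k := match k with
              | 0 => hsym p' 0
              | k'.+1 => aux k' + x ^+ k'.+1 * hsym p' k'.+1
              end) k
  end.

Lemma hsym0l k : hsym 0 k = 1. Proof. by []. Qed.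

Lemma hsymS0 p : hsym p.+1 0 = hsym p 0. Proof. by []. Qed.

Lemma hsymSS p k : hsym p.+1 k.+1 = hsym p.+1 k + x ^+ k.+1 * hsym p k.+1.
Proof. by []. Qed.

Lemma hsym0r p : hsym p 0 = 1.
Proof. by elim: p => [|p IHp]; rewrite ?hsymS0 ?hsym0l. Qed.

Lemma hsym_sum p k : hsym p.+1 k = \sum_(i < k.+1) x ^+ i * hsym p i.
Proof.
elim: k => [|k IHk]; first by rewrite big_ord1 mul1r.
by rewrite hsymSS IHk [RHS]big_ord_recr.
Qed.

(** Here the variable [1] is split off instead of [x^(k+1)]: the variables left are [x] times
    [1, ..., x^k], and homogeneity gives [x^(p+1)]. *)
Lemma hsym_pascal p k :
  hsym p.+1 k.+1 = hsym p k.+1 + x ^+ p.+1 * hsym p.+1 k.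
Proof.
elim: p k => [|p IHp]; elim=> [|k IHk].
- by rewrite hsymSS !hsymS0 !hsym0l expr1.
- by rewrite hsymSS {1}IHk (hsymSS 0 k) !hsym0l !exprS; ring.
- by rewrite hsymSS {1}IHp (hsymSS p 0) !hsym0r !exprS; ring.
by rewrite hsymSS {1}IHk {1}(IHp k.+1) (hsymSS p.+1 k) (hsymSS p k.+1) !exprS; ring.
Qed.

(** [hsym p k] is the Gaussian binomial [[p + k choose p]]; this is its absorption identity. *)
Lemma hsym_absorb p k :
  (1 - x ^+ p.+1) * hsym p.+1 k = (1 - x ^+ (p + k).+1) * hsym p k.
Proof.
case: k => [|k]; first by rewrite !hsym0r addn0.
have h1 := hsymSS p k; have h2 := hsym_pascal p k.
have -> : (1 - x ^+ p.+1) * hsym p.+1 k.+1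
        = hsym p k.+1 + x ^+ p.+1 * hsym p.+1 k - x ^+ p.+1 * hsym p.+1 k.+1.
  by rewrite mulrBl mul1r {1}h2.
by rewrite h1 -addSn exprD; ring.
Qed.

Hypothesis x0 : x != 0.

Implicit Type th : nat -> F.

(* A functional [th] is given by its values on the basis [v_h].  [raise] and
   [scale p i] are the transposes of [U : v_h |-> v_(h+1) - x^-(h+1) v_h] and of
   the diagonal operator with eigenvalues [hsym p (h + i)]; [Y_p] is
   [scale p 0].  [vac] is the coefficient of [e_0]. *)
Definition raise th h : F := th h.+1 - x ^- h.+1 * th h.

Definition scale p i th h : F := hsym p (h + i) * th h.

Definition vac h : F := x ^- ('C(h.+1, 2)).

(** The image of [U] has no component on [e_0]. *)
Lemma raise_vac h : raise vac h = 0.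
Proof.
by rewrite /raise /vac binS bin1 addnC exprD invfM subrr.
Qed.

(** [Y] crosses one [U]: consecutive eigenvalues differ by [x^(h+i+1) * hsym p (h+i+1)], and the
    factor [x^-(h+1)] of [raise] leaves [x^i], free of [h]. *)
Lemma raise_scale p i th h :
  raise (scale p.+1 i th) h
  = scale p.+1 i.+1 (raise th) h + x ^+ i * scale p i.+1 th h.
Proof.
rewrite /raise /scale !addSn !addnS !hsymSS -addSn exprD.
by field; rewrite expf_neq0.
Qed.

Lemma raise_scale0 i th h : raise (scale 0 i th) h = scale 0 i.+1 (raise th) h.
Proof. by rewrite /raise /scale !hsym0l !mul1r. Qed.

(** The transpose of [Y_(p+1) U = Y_p U + x^(p+1) U Y_(p+1) + x^p Y_p]. *)
Lemma raise_scale_pascal p th h :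
  raise (scale p.+1 0 th) h
  = raise (scale p 0 th) h + x ^+ p.+1 * scale p.+1 0 (raise th) h
    + x ^+ p * scale p 0 th h.
Proof.
rewrite /raise /scale !addn0 hsym_pascal.
have h1 := hsym_absorb p h.
have e : x ^- h.+1 * hsym p.+1 h = x ^- h.+1 * (x ^+ p.+1 * hsym p.+1 h + (1 - x ^+ (p + h).+1) * hsym p h).
  by rewrite -h1; ring.
transitivity ((hsym p h.+1 + x ^+ p.+1 * hsym p.+1 h) * th h.+1
   - (x ^- h.+1 * hsym p.+1 h) * th h); first by ring.
rewrite e -addnS exprD; field; by rewrite expf_neq0.
Qed.

Lemma eq_raise th th' : th =1 th' -> raise th =1 raise th'.
Proof. by move=> e h; rewrite /raise !e. Qed.

Lemma eq_scale p i th th' : th =1 th' -> scale p i th =1 scale p i th'.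
Proof. by move=> e h; rewrite /scale e. Qed.

Lemma raise_lin a th th' :
  raise (fun h => a * th h + th' h) =1 fun h => a * raise th h + raise th' h.
Proof. by move=> h; rewrite /raise; ring. Qed.

Lemma scale_lin p i a th th' :
  scale p i (fun h => a * th h + th' h)
  =1 fun h => a * scale p i th h + scale p i th' h.
Proof. by move=> h; rewrite /scale; ring. Qed.

Lemma scaleC p i p' i' th :
  scale p i (scale p' i' th) =1 scale p' i' (scale p i th).
Proof. by move=> h; rewrite /scale; ring. Qed.

Definition raise_if (b : bool) th := if b then raise th else th.

Definition close_if (f : bool) j th := if f then th else scale j.+1 0 th.

(* Position [i] of [bs] tells whether the value [i + 1] is a descent top, and
   position [i] of [fl] whether it has to be on the left of [i + 2].  The
   counter [j] is the length of the part of the current run already read. *)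
Fixpoint amp j (bs fl : seq bool) th : F :=
  match fl, bs with
  | f :: fl', b :: bs' =>
      amp (if f then j.+1 else 0%N) bs' fl' (close_if f j (raise_if b th))
  | _, _ => th 0%N
  end.

Lemma eq_raise_if b th th' : th =1 th' -> raise_if b th =1 raise_if b th'.
Proof. by case: b => //; apply: eq_raise. Qed.

Lemma eq_close_if f j th th' : th =1 th' -> close_if f j th =1 close_if f j th'.
Proof. by case: f => //; apply: eq_scale. Qed.

Lemma eq_amp j bs fl th th' : th =1 th' -> amp j bs fl th = amp j bs fl th'.
Proof.
elim: fl j bs th th' => [|f fl IH] j [|b bs] th th' e //=.
by apply/IH/eq_close_if/eq_raise_if.
Qed.

Lemma amp_lin j bs fl a th th' :
  amp j bs fl (fun h => a * th h + th' h) = a * amp j bs fl th + amp j bs fl th'.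
Proof.
elim: fl j bs th th' => [|f fl IH] j [|b bs] th th' //=.
rewrite -IH; apply: eq_amp => h; rewrite /close_if /raise_if.
by case: f; case: b; rewrite ?raise_lin ?scale_lin //
  (eq_scale _ _ (raise_lin _ _ _)) scale_lin.
Qed.

Lemma close_if_scale f j p i th :
  close_if f j (scale p i th) =1 scale p i (close_if f j th).
Proof. by case: f => //=; apply: scaleC. Qed.

Fixpoint bitseqs m : seq bitseq :=
  if m is m'.+1 then map (cons false) (bitseqs m') ++ map (cons true) (bitseqs m')
  else [:: [::]].

(* The weight with which [Y_p], moved to the right through [bs], changes [bs] to
   [b0] by turning some [true] into [false]. *)
Fixpoint flip_coef p i (b0 bs : bitseq) : F :=
  match b0, bs with
  | [::], [::] => hsym p i
  | true :: b0', true :: bs' => flip_coef p i.+1 b0' bs'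
  | false :: b0', false :: bs' => flip_coef p i b0' bs'
  | false :: b0', true :: bs' =>
      if p is p'.+1 then x ^+ i * flip_coef p' i.+1 b0' bs' else 0
  | _, _ => 0
  end.

(** [Y_p] is carried down to [e_0]. Each [U] on the way is either crossed, or absorbed, which turns
    its [true] into [false] and lowers [p]; both raise [i]. On [e_0] the eigenvalue is
    [hsym p i]. *)
Lemma amp_scale p i j bs fl th : size fl = size bs ->
  amp j bs fl (scale p i th)
  = \sum_(b0 <- bitseqs (size bs)) flip_coef p i b0 bs * amp j b0 fl th.
Proof.
elim: bs fl p i j th => [|b bs IH] [|f fl] //= p i j th; first by rewrite big_seq1.
case=> sz; rewrite big_cat !big_map /=.
case: b => /=; last first.
  rewrite [X in _ + X]big1 ?addr0 => [|? _]; last by rewrite mul0r.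
  by rewrite (eq_amp _ _ _ (close_if_scale _ _ _ _ _)) IH.
have e1 h : close_if f j (raise (scale p i th)) h
    = (if p is p'.+1 then x ^+ i * scale p' i.+1 (close_if f j th) h else 0)
      + scale p i.+1 (close_if f j (raise th)) h.
  case: p => [|p].
    by rewrite add0r -close_if_scale; apply: eq_close_if => h'; apply: raise_scale0.
  rewrite -!close_if_scale; case: f => /=; first by rewrite raise_scale addrC.
  rewrite -scale_lin; apply: eq_scale => {}h.
  by rewrite raise_scale addrC.
case: p e1 => [|p] e1.
  rewrite [X in X + _]big1 ?add0r => [|? _]; last by rewrite mul0r.
  rewrite -IH //; apply: eq_amp => h; rewrite e1 add0r //.
rewrite (eq_amp _ _ _ e1) amp_lin !IH // mulr_sumr; congr (_ + _).
by apply: eq_bigr => ? _; rewrite mulrA.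
Qed.

Lemma eq_iter_raise g th th' : th =1 th' -> iter g raise th =1 iter g raise th'.
Proof. by move=> e; elim: g => //= g IH; apply: eq_raise. Qed.

Lemma iter_raise_lin g a th th' :
  iter g raise (fun h => a * th h + th' h)
  =1 fun h => a * iter g raise th h + iter g raise th' h.
Proof.
elim: g => //= g IH h.
by rewrite (eq_raise IH) raise_lin.
Qed.

(* The value of [th] on [Y_j U^g e_0]. *)
Definition mom j g th : F := iter g raise (scale j 0 th) 0%N.

Lemma mom_j0 j th : mom j 0 th = th 0%N.
Proof. by rewrite /mom /= /scale addn0 hsym0r mul1r. Qed.

Lemma mom_0g g th : mom 0 g th = iter g raise th 0%N.
Proof. by rewrite /mom; apply: eq_iter_raise => h; rewrite /scale mul1r. Qed.

Lemma mom_pascal j g th :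
  mom j.+1 g.+1 th
  = mom j g.+1 th + x ^+ j.+1 * mom j.+1 g (raise th) + x ^+ j * mom j g th.
Proof.
rewrite /mom !iterSr.
rewrite (eq_iter_raise _ (raise_scale_pascal _ _)).
transitivity (iter g raise (fun h => x ^+ j * scale j 0 th h +
   (x ^+ j.+1 * scale j.+1 0 (raise th) h + raise (scale j 0 th) h)) 0%N).
  by apply: eq_iter_raise => h; ring.
by rewrite !iter_raise_lin; ring.
Qed.

(** A twin of [mom_pascal] whose powers of [x] depend on [g] instead of [j]. In the double induction
    [mom_pascal] expands the terms until the induction hypotheses apply. *)
Lemma mom_step j g th :
  mom j.+1 g.+1 th
  = mom j.+1 g (raise th) + x ^+ g.+1 * mom j g.+1 th + x ^+ g * mom j g th.
Proof.
elim: j g th => [|j IHj] g th.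
  elim: g th => [|g IHg] th; first by rewrite mom_pascal !mom_0g !mom_j0 /= expr1; ring.
  rewrite [LHS]mom_pascal [in LHS]IHg [in RHS](mom_pascal 0 g) !mom_0g !iterSr !exprS; ring.
elim: g th => [|g IHg] th.
  by rewrite [LHS]mom_pascal [in LHS]IHj [in RHS](mom_pascal j 0) !mom_j0 !exprS; ring.
rewrite [LHS]mom_pascal [in LHS]IHg [in LHS](IHj g.+1) [in LHS](IHj g th).
rewrite [in RHS](mom_pascal j.+1 g) [in RHS](mom_pascal j g.+1) [in RHS](mom_pascal j g th).
by rewrite !exprS; ring.
Qed.

(** Iteration of [mom_step] on [g]. The index [i] will be the number of blocks to the left of an
    inserted letter; the two sums correspond to keeping or not a gap just before it. *)
Lemma mom_sum j g th :
  mom j.+1 g th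
  = \sum_(i < g.+1) x ^+ i * mom j i (iter (g - i) raise th)
    + \sum_(i < g) x ^+ i * mom j i (iter (g - i.+1) raise th).
Proof.
elim: g th => [|g IHg] th.
  by rewrite big_ord1 big_ord0 addr0 !mom_j0 mul1r.
rewrite mom_step IHg [in RHS]big_ord_recr [X in _ = _ + X]big_ord_recr /= !subnn /=.
rewrite -addrA addrACA; congr (_ + _ + (_ + _)).
  by apply: eq_bigr => i _; rewrite (subSn (leq_ord i)) iterSr.
by apply: eq_bigr => i _; rewrite (subSn (ltn_ord i)) iterSr.
Qed.

End Algebra.

Arguments hsym : simpl never.

(** * Subexcedent words and the masks of the sets built by [LC] *)

(* The set [S] of the definition of [LC] is encoded by the list of the booleans
   [y \in S] for [y = m, ..., 1], where [m] is the number of letters read. *)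
Fixpoint flip_false r (M : bitseq) : bitseq :=
  if M is b :: M' then
    if ~~ b && ((count negb M').+1 == r) then true :: M' else b :: flip_false r M'
  else [::].

(** The new leading [false] is correct for subexcedent words: a letter is at most the number [m] of
    letters to its right, hence inserts only elements of [1, ..., m]. *)
Definition lc_mask_step k (M : bitseq) : bitseq :=
  false :: (if (k <= count id M)%N then M else flip_false (k - count id M) M).

Definition lc_mask (u : seq nat) : bitseq := foldr lc_mask_step [::] u.

Fixpoint mask_maj (bs : bitseq) : nat :=
  if bs is b :: bs' then (b * (size bs').+1 + mask_maj bs')%N else 0.

Fixpoint sub_seqs m : seq (seq nat) :=
  if m is m'.+1 then [seq k :: u | u <- sub_seqs m', k <- iota 0 m'.+1]
  else [:: [::]].

Fixpoint asc_ok (fl : seq bool) (u : seq nat) : bool :=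
  match fl, u with
  | f :: fl', k :: u' => (f ==> (k <= head 0 u')%N) && asc_ok fl' u'
  | _, _ => true
  end.

Lemma flip_false_cat pre suf :
  flip_false (count negb suf).+1 (pre ++ false :: suf) = pre ++ true :: suf.
Proof.
elim: pre => [|b pre IH] /=; first by rewrite eqxx.
by rewrite IH count_cat /= gtn_eqF ?andbF // ltnS addnS ltnS leq_addl.
Qed.

Lemma size_flip_false r M : size (flip_false r M) = size M.
Proof. by elim: M => //= b M IH; case: ifP => //= _; rewrite IH. Qed.

Lemma size_lc_mask u : size (lc_mask u) = size u.
Proof. by elim: u => //= k u <-; case: ifP => //; rewrite size_flip_false. Qed.

Lemma big_sub_seqs (R : nmodType) m (P : pred (seq nat)) (f : seq nat -> R) :
  (\sum_(v <- sub_seqs m.+1 | P v) f v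
  = \sum_(u <- sub_seqs m) \sum_(k < m.+1 | P (\val k :: u)) f (\val k :: u))%R.
Proof.
rewrite big_mkcond [sub_seqs _]/sub_seqs -/sub_seqs big_allpairs_dep.
apply: eq_bigr => u _.
by rewrite -big_mkcond -[iota 0 m.+1]/(index_iota 0 m.+1) big_mkord.
Qed.

Lemma mem_sub_seqsS m v :
  reflect (exists2 u, u \in sub_seqs m & exists2 k, (k <= m)%N & v = k :: u)
    (v \in sub_seqs m.+1).
Proof.
apply: (iffP allpairsP) => [[[u k] /= [um]]|[u um [k km ->]]].
  by rewrite -[_ :: iota _ _]/(iota 0 m.+1) mem_iota ltnS => /andP[_ km] ->; exists u => //; exists k.
by exists (u, k); rewrite /= -1?[_ :: iota _ _]/(iota 0 m.+1) mem_iota.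
Qed.

Lemma sub_seqs_size m u : u \in sub_seqs m -> size u = m.
Proof.
elim: m u => [|m IH] u; first by rewrite inE => /eqP->.
by case/mem_sub_seqsS => v /IH <- [k _ ->].
Qed.

Lemma sub_seqs_head m u : u \in sub_seqs m -> (head 0 u <= m)%N.
Proof.
case: m => [|m]; first by rewrite inE => /eqP->.
by case/mem_sub_seqsS => v _ [k /leqW le_km ->].
Qed.

Lemma mem_bitseqs m bs : (bs \in bitseqs m) = (size bs == m).
Proof.
elim: m bs => [|m IH] [|b bs] /=; rewrite ?inE ?mem_cat //.
  by apply/negbTE; rewrite negb_or; apply/andP; split; apply/mapP => -[].
have inj (c : bool) : injective (cons c) by move=> ? ? [].
rewrite eqSS -IH; case: b; rewrite (mem_map (inj _)) ?orbF ?orFb.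
  by case: mapP => // -[].
by case: (X in _ || X) / mapP => [[]|]; rewrite ?orbF.
Qed.

Lemma bitseqs_uniq m : uniq (bitseqs m).
Proof.
have inj (c : bool) : injective (cons c) by move=> ? ? [].
elim: m => //= m IH; rewrite cat_uniq !(map_inj_uniq (inj _)) IH andbT /=.
by apply/hasPn => _ /mapP[s _ ->]; apply/mapP => -[].
Qed.

Lemma nseq_cons_cat p (b : bool) s : nseq p b ++ b :: s = nseq p.+1 b ++ s.
Proof. by elim: p => //= p ->. Qed.

(** * The recursion for words *)

Section LHS.

Local Open Scope ring_scope.

Variables (F : fieldType) (x : F).
Hypothesis x0 : x != 0.

Local Notation hsym := (hsym x).
Local Notation flip_coef := (flip_coef x).

Implicit Type G : bitseq -> F.

(** The [p] next letters of a run, read from right to left, weakly decreasing and bounded by [K];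
    [G] is a test function on the final mask. *)
Fixpoint run p K (M : bitseq) G : F :=
  if p is p'.+1 then \sum_(k < K.+1) x ^+ k * run p' k (lc_mask_step k M) G
  else G M.

(** Letters at most [|S|] insert nothing, and weakly decreasing words with letters at most [K] index
    the monomials of [h_p(1, ..., x^K)]. *)
Lemma run_small p K M G : (K <= count id M)%N ->
  run p K M G = hsym p K * G (nseq p false ++ M).
Proof.
elim: p K M => [|p IH] K M leK; first by rewrite /= mul1r.
rewrite /= hsym_sum mulr_suml; apply: eq_bigr => k _.
have lek : (k <= count id M)%N by apply: leq_trans leK; rewrite -ltnS.
rewrite /lc_mask_step lek IH //= mulrA; congr (_ * G _).
by rewrite nseq_cons_cat.
Qed.

(* [pre] is the part of the mask that the bound [K] on the letters still to be
   read protects from being changed. *)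
Lemma run_flip p pre suf G :
  run p (count id pre + size suf) (pre ++ suf) G * x ^+ mask_maj suf
  = \sum_(bs <- bitseqs (size suf)) flip_coef p (count id pre) suf bs
      * x ^+ mask_maj bs * G (nseq p false ++ pre ++ bs).
Proof.
elim: p pre suf => [|p IHp] pre suf; elim: suf pre => [|b suf IHs] pre.
- by rewrite big_seq1 addn0 !cats0 run_small //= !mulr1.
- rewrite -cat_rcons /= big_cat !big_map; case: b => /=.
    rewrite big1 ?add0r => [|? _]; last by rewrite !mul0r.
    have /= := IHs (rcons pre true).
    rewrite -cats1 count_cat /= addn0 addn1 exprD mulrCA => ->.
    rewrite mulr_sumr !big_seq; apply: eq_bigr => bs.
    rewrite mem_bitseqs => /eqP sz.
    by rewrite -!catA /= !mul1n sz !exprD; ring.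
  rewrite [X in _ + X]big1 ?addr0 => [|? _]; last by rewrite !mul0r.
  have /= := IHs (rcons pre false).
  rewrite -cats1 count_cat /= !addn0 => ->.
  by apply: eq_bigr => bs _; rewrite -!catA.
- by rewrite big_seq1 addn0 !cats0 run_small //= !mulr1.
(* A leading [true] of [suf] passes to [pre] without changing the bound. *)
rewrite -cat_rcons [bitseqs _]/= big_cat !big_map; case: b => /=.
  rewrite [X in _ = X + _]big1 ?add0r => [|? _]; last by rewrite !mul0r.
  have /= := IHs (rcons pre true).
  rewrite -cats1 count_cat /= addn0 addn1 addSnnS exprD mulrCA => ->.
  rewrite mulr_sumr !big_seq; apply: eq_bigr => bs.
  rewrite mem_bitseqs => /eqP sz.
  by rewrite -!catA /= !mul1n sz !exprD; ring.
(* If the first letter is below the bound, the leading [false] becomes protected; if it equals the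
   bound, it flips this [false]. *)
rewrite addnS big_ord_recr mulrDl; congr (_ + _).
  have /= := IHs (rcons pre false).
  rewrite -cats1 count_cat /= !addn0 => ->.
  by apply: eq_bigr => bs _; rewrite -!catA.
have cfK : (count id (pre ++ false :: suf) = count id pre + count id suf)%N.
  by rewrite count_cat.
have ltK : (count id suf < (size suf).+1)%N by rewrite ltnS count_size.
(* For the letter equal to the bound, the rank [k - |S|] is one more than the number of [false] in
   [suf]. *)
rewrite /= ?cat_rcons -?catA /= /lc_mask_step cfK -addnS leq_add2l leqNgt ltK /= subnDl subSn ?count_size //.
have -> : (size suf - count id suf = count negb suf)%N.
  by rewrite -(count_predC id suf) addKn.
rewrite flip_false_cat.
have := IHp (rcons (false :: pre) true) suf.
rewrite -cats1 count_cat /= addn0 addn1 addSn add0n => e.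
rewrite -mulrA -catA /= in e *.
rewrite {2}addnS e mulr_sumr !big_seq; apply: eq_bigr => bs.
rewrite mem_bitseqs => /eqP sz.
rewrite nseq_cons_cat -(catA pre) /= !mul1n sz !exprD; ring.
Qed.


(** Words constrained by [fl], extended on the left by [j] more letters of the run of their first
    letter. *)
Definition sub_sum j (fl : seq bool) G : F :=
  \sum_(u <- sub_seqs (size fl) | asc_ok fl u)
     x ^+ sumn u * run j (head 0%N u) (lc_mask u) G.

(** A constrained letter is bounded by [head 0 u], which is at most the subexcedent bound: its sum
    is one more step of [run]. *)
Lemma sub_sum_true j fl G : sub_sum j (true :: fl) G = sub_sum j.+1 fl G.
Proof.
rewrite /sub_sum big_sub_seqs [RHS]big_mkcond !big_seq; apply: eq_bigr => u um /=.
case: (asc_ok fl u); last by rewrite big1 // => k; rewrite andbF.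
rewrite mulr_sumr (big_ord_widen_cond (size fl).+1 predT
  (fun k => x ^+ sumn u * (x ^+ k * run j k (lc_mask_step k (lc_mask u)) G))) /=; last first.
  by rewrite ltnS; apply: sub_seqs_head.
apply: eq_big => [k|k _]; first by rewrite andbT ltnS.
by rewrite exprD mulrA [x ^+ sumn u * _]mulrC.
Qed.

(** A letter without constraint starts a run; it is bounded by the number of letters to its right,
    which is the length of the mask. *)
Lemma sub_sum_false j fl G :
  sub_sum j (false :: fl) G
  = \sum_(u <- sub_seqs (size fl) | asc_ok fl u)
      x ^+ sumn u * run j.+1 (size (lc_mask u)) (lc_mask u) G.
Proof.
rewrite /sub_sum big_sub_seqs [RHS]big_mkcond !big_seq; apply: eq_bigr => u um /=.
case: (asc_ok fl u); last by rewrite big1.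
rewrite mulr_sumr size_lc_mask (sub_seqs_size um); apply: eq_bigr => k _.
by rewrite exprD mulrA [x ^+ sumn u * _]mulrC.
Qed.

Lemma run_size p M G :
  run p (size M) M G
  = \sum_(bs <- bitseqs (size M)) x ^- mask_maj M * (flip_coef p 0 M bs
      * x ^+ mask_maj bs * G (nseq p false ++ bs)).
Proof.
have /= := run_flip p [::] M G; rewrite add0n => e.
by rewrite -mulr_sumr -e mulrCA mulVf ?mulr1 // expf_neq0.
Qed.

(** After [j] letters of a run the mask starts with [j] bits [false], so [G] is evaluated only
    there. *)
Lemma sub_sum0 j fl G : (forall M, G (nseq j false ++ M) = 0) -> sub_sum j fl G = 0.
Proof.
elim: fl j => [|[] fl IH] j G0.
- by rewrite /sub_sum big_seq1 run_small // G0 !mulr0.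
- rewrite sub_sum_true IH // => M.
  by rewrite -nseq_cons_cat G0.
rewrite sub_sum_false big1 // => u _; rewrite run_size big1 ?mulr0 // => bs _.
by rewrite -nseq_cons_cat G0 !mulr0.
Qed.

Lemma amp0 j bs fl th : th =1 (fun _ => 0) -> amp x j bs fl th = 0.
Proof.
move=> e; rewrite (eq_amp x j bs fl (th' := fun h => 0 * th h + th h)) => [|h].
  have := amp_lin x j bs fl (-1) th th; rewrite mulN1r addNr => <-.
  by apply: eq_amp => h; rewrite !e !mulr0 addr0.
by rewrite !e mulr0 addr0.
Qed.

(** The two recursions agree: at each end of a run, [run_size] on words and [amp_scale] on operators
    give the same weights [flip_coef], and the powers of [x] given by [mask_maj] telescope. *)
Lemma sub_sumE j bs fl : size fl = size bs ->
  sub_sum j fl (fun M => (M == nseq j false ++ bs)%:R)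
  = amp x j bs fl (vac x) * x ^+ mask_maj bs.
Proof.
elim: fl j bs => [|f fl IH] j [|b bs] //= => [_|[sz]].
  by rewrite /sub_sum big_seq1 run_small // hsym0r eqxx /vac bin_small // !expr0 invr1 !mulr1.
have hd b' M : (nseq j false ++ b' :: M == nseq j false ++ b :: bs)
    = (b' == b) && (M == bs) by rewrite eqseq_cat // eqxx.
(* In both cases a bit [b = true] gives zero on both sides: the run leaves only [false] there, and
   [vac] vanishes on the image of [U]. *)
case: f => /=.
  rewrite sub_sum_true; case: b hd => hd.
    rewrite sub_sum0 => [|M]; last by rewrite -nseq_cons_cat hd.
    by rewrite amp0 ?mul0r // => h; apply: raise_vac.
  by rewrite nseq_cons_cat IH.
rewrite sub_sum_false; case: b hd => hd.
  rewrite amp0 ?mul0r => [|h]; last by rewrite /scale /= raise_vac ?mulr0.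
  rewrite big1 // => u _; rewrite run_size big1 ?mulr0 // => M _.
  by rewrite -nseq_cons_cat hd !mulr0.
rewrite amp_scale // mul0n add0n mulr_suml.
(* [b0] is the mask of the letters to the right of the run. *)
transitivity (\sum_(b0 <- bitseqs (size bs)) flip_coef j.+1 0 b0 bs
    * (x ^+ mask_maj bs * x ^- mask_maj b0)
    * \sum_(u <- sub_seqs (size fl) | asc_ok fl u) x ^+ sumn u * (lc_mask u == b0)%:R).
  under [RHS]eq_bigr => b0 _ do rewrite mulr_sumr.
  rewrite [RHS]exchange_big big_seq_cond [RHS]big_seq_cond; apply: eq_bigr => u /andP[um _].
  have szu : size (lc_mask u) = size bs by rewrite size_lc_mask (sub_seqs_size um).
  rewrite run_size [RHS](bigD1_seq (lc_mask u)) ?bitseqs_uniq ?mem_bitseqs ?szu //.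
  rewrite [X in _ * X = _](bigD1_seq bs) ?bitseqs_uniq ?mem_bitseqs //.
  have hd' M : (false :: nseq j false ++ M == nseq j false ++ false :: bs) = (M == bs).
    by rewrite -[false :: _]/(nseq j.+1 false ++ M) -nseq_cons_cat hd.
  rewrite /= hd' !eqxx.
  rewrite [X in _ + X]big1 => [|M neM]; last by rewrite hd' (negPf neM) !mulr0.
  rewrite [X in _ = _ + X]big1 => [|M neM]; last first.
    by rewrite eq_sym (negPf neM) !mulr0.
  ring.
rewrite !big_seq; apply: eq_bigr => b0; rewrite mem_bitseqs => /eqP sz0.
have := IH 0%N b0 (etrans sz (esym sz0)); rewrite /sub_sum /= => ->.
by field; rewrite expf_neq0.
Qed.

End LHS.

(** * Partial permutations and the insertion of their next smaller value *)

(* A partial permutation is a word in which the letter [0] stands for a place to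
   be filled with smaller values: it starts with [0] and has no two adjacent
   [0]'s.  The value [c] is inserted at some [0], keeping or not a [0] on its left
   (always kept for the first [0]), and keeping a [0] on its right if [b], that is
   if [c] is a descent top. *)
Definition put (b : bool) c (t : seq nat) : seq nat := c :: (if b then 0 :: t else t).

Arguments put : simpl never.

Fixpoint repl b c (s : seq nat) : seq (seq nat) :=
  if s is y :: t then
    (if y == 0 then [:: put b c t; 0 :: put b c t] else [::])
      ++ map (cons y) (repl b c t)
  else [::].

Definition children b c (w : seq nat) : seq (seq nat) :=
  if w is y :: s then (y :: put b c s) :: map (cons y) (repl b c s) else [::].

Fixpoint words n (bs : bitseq) : seq (seq nat) :=
  if bs is b :: bs' then
    flatten [seq children b (n - size bs') w | w <- words n bs']
  else [:: [:: 0]].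

(** In a partial permutation a [0] already plays the 1 of the patterns 31-2 that its future contents
    will create with the present letters. *)
Fixpoint tot_word (w : seq nat) : nat :=
  if w is a :: w' then
    (if w' is b :: t then count (fun y => b < y < a) t else 0) + tot_word w'
  else 0.

Definition gaps (w : seq nat) : nat := count_mem 0 w.

Arguments gaps : simpl never.

Lemma gaps_cat s t : gaps (s ++ t) = gaps s + gaps t.
Proof. exact: count_cat. Qed.

Lemma gaps_cons y s : gaps (y :: s) = (y == 0) + gaps s.
Proof. by []. Qed.

(** The first gap has no letter on its left and closes no block, hence the predecessor. *)
Definition gaps_before c (w : seq nat) : nat := (gaps (take (index c w) w)).-1.

Definition not_both0 (a b : nat) : bool := (0 < a) || (0 < b).

(* The word [y :: a ++ put b c r] before the insertion of [c]. *)
Definition fill y (a r : seq nat) : seq nat :=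
  y :: a ++ (if last y a == 0 then r else 0 :: r).

Definition above c (s : seq nat) : bool := all (fun y => (y == 0) || (c < y)) s.

Lemma tot_word0 r : tot_word (0 :: r) = tot_word r.
Proof.
case: r => //= b t; rewrite (eq_count (a2 := pred0)) ?count_pred0 // => y.
by rewrite /= ltn0 andbF.
Qed.

Lemma count_below c y r : above c r -> count (fun z => y < z < c) r = 0.
Proof.
move=> /allP ar; apply/eqP; rewrite -leqn0 leqNgt -has_count; apply/hasPn => z /ar.
by case/orP=> [/eqP-> // | lt_cz]; rewrite (ltnNge z c) (ltnW lt_cz) andbF.
Qed.

Lemma count_from0 c y r : 0 < c -> above c r ->
  count (fun z => c < z < y) r = count (fun z => 0 < z < y) r.
Proof.
move=> c0 /allP ar; apply: eq_in_count => z /ar /orP[/eqP-> // | lt_cz].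
by rewrite lt_cz (ltn_trans c0).
Qed.

Lemma count_if0 y z (b : bool) r :
  count (fun x => y < x < z) (if b then 0 :: r else r) = count (fun x => y < x < z) r.
Proof. by case: b. Qed.

Lemma tot_word_put b c r : above c r -> tot_word (put b c r) = tot_word r.
Proof.
move=> ar; rewrite /put; case: b.
  by rewrite -[RHS]tot_word0 /= (count_below 0).
case: r ar => //= y r /andP[_ ar].
by rewrite (count_below y).
Qed.

(** The new patterns have [c] as their 2, one for each gap of [a]. As a 1, [c] counts the same
    letters of [r] as the [0] it replaces, since they exceed [c]; it is never a 3. *)
Lemma tot_word_fill b c y a r :
    0 < c -> path not_both0 y a -> above c (y :: a) -> above c r ->
  tot_word (y :: a ++ put b c r) = tot_word (fill y a r) + gaps a.
Proof.
move=> c0; elim: a y => [|y2 a IH] y.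
  move=> _ /andP[y0 _] ar.
  have -> : tot_word (y :: [::] ++ put b c r)
      = count (fun z => c < z < y) (if b then 0 :: r else r) + tot_word (put b c r) by [].
  rewrite count_if0 tot_word_put // count_from0 // addn0 /fill /last cat0s.
  case: eqP y0 => [-> _|_ _]; last first.
    rewrite -[X in _ + X]tot_word0.
    by have -> : tot_word (y :: 0 :: r) = count (fun z => 0 < z < y) r + tot_word (0 :: r) by [].
  by rewrite tot_word0 (eq_count (a2 := pred0)) ?count_pred0 // => z; rewrite /= ltn0 andbF.
case/andP=> yy2 pa /andP[ay aa] ar.
have -> : tot_word (y :: (y2 :: a) ++ put b c r)
    = count (fun z => y2 < z < y) (a ++ put b c r) + tot_word (y2 :: a ++ put b c r) by [].
have -> : tot_word (fill y (y2 :: a) r)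
    = count (fun z => y2 < z < y) (a ++ if last y2 a == 0 then r else 0 :: r)
      + tot_word (fill y2 a r) by [].
rewrite IH // -[gaps (y2 :: a)]/((y2 == 0) + gaps a).
suff -> : count (fun z => y2 < z < y) (a ++ put b c r)
    = count (fun z => y2 < z < y) (a ++ if last y2 a == 0 then r else 0 :: r) + (y2 == 0).
  lia.
rewrite !count_cat -addnA; congr (_ + _); rewrite -if_neg count_if0 addnC.
rewrite /put /= count_if0; congr (_ + _).
case/andP: aa; case: eqP => [y20 _ _|_ /= lt_cy2 _]; last first.
  by rewrite (ltnNge y2 c) (ltnW lt_cy2).
rewrite y20 /not_both0 orbF in yy2 *.
by move: ay yy2; rewrite c0 /=; case: (y) => //= ? ->.
Qed.

Arguments tot_word : simpl never.

Lemma put_cat b c t T : put b c t ++ T = put b c (t ++ T).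
Proof. by case: b. Qed.

Lemma gaps_put b c t : 0 < c -> gaps (put b c t) = b + gaps t.
Proof. by rewrite /gaps /put lt0n /= => /negPf ->; case: b. Qed.

Lemma above_notin c s : 0 < c -> above c s -> c \notin s.
Proof.
move=> c0 /allP ac; apply/negP => /ac; rewrite ltnn orbF => /eqP c0'.
by rewrite c0' in c0.
Qed.

Lemma gaps_before_put b c a r : 0 < c -> above c a ->
  gaps_before c (0 :: a ++ put b c r) = gaps a.
Proof.
move=> c0 ac; rewrite /gaps_before /put /= eq_sym gtn_eqF //.
by rewrite index_cat (negPf (above_notin c0 ac)) /= eqxx addn0 take_size_cat.
Qed.

(** Induction on [s], with [a] the part already passed and [T] a suffix left untouched; each gap of
    [s] yields two words. *)
Lemma repl_sum (R : nmodType) (f : nat -> nat -> nat -> R) b c a s T :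
    0 < c -> path not_both0 0 (a ++ s ++ T) -> above c (a ++ s ++ T) ->
  let t := tot_word (0 :: a ++ s ++ T) in let h := gaps (a ++ s ++ T) in
  (\sum_(s' <- repl b c s) f (tot_word (0 :: a ++ s' ++ T))
      (gaps_before c (0 :: a ++ s' ++ T)) (gaps (a ++ s' ++ T))
  = \sum_(i < gaps s)
      (f (t + (gaps a + i))%N (gaps a + i)%N (h.-1 + b)%N
       + f (t + (gaps a + i).+1)%N (gaps a + i).+1 (h + b)%N))%R.
Proof.
move=> c0; elim: s a => [|y s IH] a pw aw /=; first by rewrite big_nil big_ord0.
have e : a ++ y :: s ++ T = rcons a y ++ s ++ T by rewrite cat_rcons.
have gr : gaps (rcons a y) = gaps a + (y == 0).
  by rewrite /gaps -cats1 count_cat /= addn0.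
have := IH (rcons a y); rewrite -e => /(_ pw aw) /=.
rewrite big_cat big_map /= gr => {IH}IH.
under [X in (_ + X)%R]eq_bigr => s' _ do rewrite -cat_rcons.
rewrite IH; case: eqP IH gr e => [y0 _ gr e|/eqP ny _ gr e]; last first.
  rewrite big_nil add0r /= -[gaps (y :: s)]/((y == 0) + gaps s) (negPf ny) /=.
  by under eq_bigr do rewrite addn0.
subst y; rewrite -[gaps (0 :: s)]/(gaps s).+1 big_ord_recl.
have [pa la] : path not_both0 0 a /\ last 0 a != 0.
  move: pw; rewrite cat_path => /andP[-> /andP[]].
  by rewrite /not_both0 orbF lt0n.
have [aa as' aT] : [/\ above c a, above c s & above c T].
  by move: aw; rewrite /above !all_cat /= => /and3P[-> -> ->].
have ar : above c (s ++ T) by rewrite /above all_cat; apply/andP.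
have sz : gaps (a ++ 0 :: s ++ T) = (gaps a + gaps (s ++ T)).+1.
  by rewrite /gaps count_cat /= add1n addnS.
congr (_ + _)%R.
  rewrite !big_cons big_nil addr0 cat_cons !put_cat -[a ++ 0 :: put b c _]cat_rcons.
  have par : path not_both0 0 (rcons a 0) by rewrite rcons_path pa /not_both0 lt0n la.
  have aar : above c (rcons a 0) by rewrite /above all_rcons.
  rewrite !tot_word_fill // !gaps_before_put // gr.
  rewrite /fill last_rcons (negPf la) cat_rcons sz /=.
  rewrite !gaps_cat gaps_put // gr !addn0 addn1 gaps_cat.
  by rewrite !addnS !addSn /= !(addnCA _ (nat_of_bool b)) ![b + _]addnC.
by apply: eq_bigr => i _; rewrite lift0 -addnA add1n.
Qed.

(** The words are regrouped by the number [i] of blocks to the left of [c]. The first sum keeps a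
    gap just before [c], the second does not; the first gap of the word occurs only in the first
    sum. *)
Lemma children_sum (R : nmodType) (f : nat -> nat -> nat -> R) b c s T :
    0 < c -> path not_both0 0 (s ++ T) -> above c (s ++ T) ->
  let t := tot_word (0 :: s ++ T) in let h := gaps (s ++ T) in
  (\sum_(w' <- children b c (0 :: s)) f (tot_word (w' ++ T))
      (gaps_before c (w' ++ T)) (gaps (w' ++ T)).-1
  = \sum_(i < (gaps s).+1) f (t + i)%N i (h + b)%N
    + \sum_(i < gaps s) f (t + i)%N i (h.-1 + b)%N)%R.
Proof.
move=> c0 ps ac t h; rewrite big_cons big_map.
transitivity (f t 0 (h + b) + \sum_(i < gaps s)
    (f (t + i)%N i (h.-1 + b)%N + f (t + i.+1)%N i.+1 (h + b)%N))%R.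
  congr (_ + _)%R; last exact: (@repl_sum R f b c [::] s T c0 ps ac).
  rewrite cat_cons put_cat (@gaps_before_put b c [::]) // gaps_cons gaps_put //.
  have := @tot_word_fill b c 0 [::] _ c0 isT isT ac.
  by rewrite /fill /= addn0 => ->; rewrite -/t /= [b + _]addnC.
rewrite big_split big_ord_recl -addrA; congr (f _ _ _ + _)%R; first by rewrite addn0.
by rewrite addrC.
Qed.

Lemma replP b c s w' :
  reflect (exists a r, s = a ++ 0 :: r /\
             (w' = a ++ put b c r \/ w' = a ++ 0 :: put b c r))
    (w' \in repl b c s).
Proof.
apply: (iffP idP) => [|[a [r [-> w'E]]]].
  elim: s w' => [|y s IH] w' //=; rewrite mem_cat => /orP[|/mapP[u /IH[a [r [-> uE]]] ->]].
    case: eqP => // ->; rewrite !inE => /orP[] /eqP->; exists [::], s; split=> //; first by left.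
    by right.
  by exists (y :: a), r; split => //; case: uE => ->; [left|right].
elim: a w' w'E => [|y a IH] w' /= w'E.
  by rewrite !inE; case: w'E => ->; rewrite eqxx ?orbT.
rewrite mem_cat; apply/orP; right.
by case: w'E => ->; apply/map_f/IH; [left|right].
Qed.

(** Insertion is undone by [fill], so that a child determines its parent. *)
Lemma childrenP b c s w' : path not_both0 0 s ->
  reflect (exists a r, w' = 0 :: a ++ put b c r /\ 0 :: s = fill 0 a r)
    (w' \in children b c (0 :: s)).
Proof.
move=> ps; apply: (iffP idP) => [|[a [r [-> []]]]].
  rewrite inE => /orP[/eqP->|/mapP[u /replP[a [r [sE uE]]] ->]].
    by exists [::], s.
  have la : last 0 a != 0.
    by move: ps; rewrite sE cat_path /= /not_both0 orbF lt0n => /and3P[].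
  case: uE => ->; first by exists a, r; rewrite /fill (negPf la) sE.
  by exists (rcons a 0), r; rewrite /fill last_rcons /= !cat_rcons sE.
rewrite inE; case: eqP => [la|/eqP la] ->.
  case/lastP: a la => [|a y]; first by rewrite eqxx.
  rewrite last_rcons => ->; apply/orP; right; apply/map_f/replP.
  by exists a, r; rewrite !cat_rcons; split; [|right].
by apply/orP; right; apply/map_f/replP; exists a, r; split; [|left].
Qed.

(** * Descent tops, relative positions and admissible states under insertion *)

Definition descent_at d w := nth d w (index d w).+1 < d.

Lemma descent_at_cons d y u :
  descent_at d (y :: u) = if y == d then head d u < d else descent_at d u.
Proof. by rewrite /descent_at /=; case: ifP => //= _; rewrite nth0. Qed.

(** The letter [c] and the gap that it replaces are both smaller than [d]. *)
Lemma descent_at_fill d b c y a r : 0 < c < d ->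
  descent_at d (y :: a ++ put b c r) = descent_at d (fill y a r).
Proof.
case/andP=> c0 lt_cd; have d0 := ltn_trans c0 lt_cd.
have e0 u : descent_at d (0 :: u) = descent_at d u.
  by rewrite descent_at_cons eq_sym (gtn_eqF d0).
elim: a y => [|y2 a IH] y; last first.
  by rewrite cat_cons descent_at_cons IH [RHS]descent_at_cons.
rewrite /put /fill /= !descent_at_cons /= (ltn_eqF lt_cd) lt_cd.
case: (eqVneq d y) => [<-|_]; first by rewrite (gtn_eqF d0) /= d0.
by case: b; case: ifP; rewrite ?e0.
Qed.

(** Without a gap after it, [c] is last or followed by a larger letter, as [r] does not start with
    [0]. *)
Lemma descent_at_put b c u r : 0 < c -> c \notin u -> above c r -> path not_both0 0 r ->
  descent_at c (u ++ put b c r) = b.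
Proof.
move=> c0; elim: u => [|y u IH] /=.
  move=> _ ar pr; rewrite /put descent_at_cons eqxx; case: b => //=.
  case: r ar pr => /= [|y r]; first by rewrite ltnn.
  case/andP=> cy _ /andP[y0 _]; apply/negbTE; rewrite -leqNgt.
  by case/orP: cy y0 => [/eqP-> // | /ltnW].
rewrite inE negb_or => /andP[ny cu] ar pr.
by rewrite descent_at_cons eq_sym (negPf ny) IH.
Qed.

Lemma index_filter_ltn (P : pred nat) d d' s : P d -> P d' ->
  (index d (filter P s) < index d' (filter P s)) = (index d s < index d' s).
Proof.
move=> Pd Pd'; elim: s => //= y s IH; case: ifP => Py /=.
  by case: (eqVneq y d); case: (eqVneq y d').
have [-> ->] : (y == d) = false /\ (y == d') = false.
  by split; apply/negbTE/eqP => yE; rewrite yE ?Pd ?Pd' in Py.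
by rewrite ltnS.
Qed.

(* [index] is the size of the word for an absent letter, so that the condition
   holds for the largest letter. *)
Fixpoint before_ok c (fl : seq bool) (w : seq nat) : bool :=
  if fl is f :: fl' then (f ==> (index c w < index c.+1 w)) && before_ok c.+1 fl' w
  else true.

Lemma before_ok_filter c c' fl w : c' < c ->
  before_ok c fl [seq y <- w | c' < y] = before_ok c fl w.
Proof.
elim: fl c => //= f fl IH c lt_c; have lt_c1 : c' < c.+1 := leqW lt_c.
by rewrite IH // (@index_filter_ltn (fun y => c' < y)).
Qed.

Definition state c m w :=
  [&& head 1 w == 0, path not_both0 0 (behead w)
    & perm_eq [seq y <- w | 0 < y] (iota c m)].

Lemma state_cons c m w : state c m w -> w = 0 :: behead w.
Proof. by case: w => // y w /andP[/eqP /= ->]. Qed.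

Lemma state_above c m w : state c.+1 m w -> above c w.
Proof.
case/and3P=> _ _ /perm_mem pw; apply/allP => y yw; have := pw y.
rewrite mem_filter yw andbT mem_iota; case: y {yw} => //= y.
by move/esym/andP=> [].
Qed.

Lemma path0_drop r : path not_both0 0 r -> forall y, path not_both0 y r.
Proof. by case: r => //= z r /andP[]; rewrite /not_both0 /= => -> -> y; rewrite orbT. Qed.

Lemma fill_path a r s : path not_both0 0 s -> 0 :: s = fill 0 a r ->
  path not_both0 0 a /\ path not_both0 0 r.
Proof.
move=> ps []; case: eqP => [la|la] sE; move: ps; rewrite sE cat_path => /andP[-> ].
  by rewrite la.
by case/andP.
Qed.

Lemma fill_filter (P : pred nat) b c a r : ~~ P 0 -> ~~ P c ->
  filter P (0 :: a ++ put b c r) = filter P (fill 0 a r).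
Proof.
move=> P0 Pc; rewrite /fill /= !filter_cat /put /= (negPf P0) (negPf Pc).
by congr (_ ++ _); case: b; case: ifP; rewrite /= ?(negPf P0).
Qed.

Lemma fill_above c a r s : 0 :: s = fill 0 a r -> above c (0 :: s) -> above c a /\ above c r.
Proof.
by rewrite /fill /= => -[->]; rewrite /above /= all_cat => /andP[->]; case: ifP.
Qed.

Lemma children_state b c m w w' : 0 < c -> state c.+1 m w ->
  w' \in children b c w -> state c m.+1 w'.
Proof.
move=> c0 st; have aw := state_above st.
case/and3P: (st) => _ ps pw; rewrite (state_cons st) in pw aw *.
case/(childrenP _ _ _ ps) => a [r [-> sE]].
have [pa pr] := fill_path ps sE; have [aa ar] := fill_above sE aw.
rewrite /state /= cat_path pa /put /= {1}/not_both0 c0 orbT /=.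
apply/andP; split.
  by case: b; rewrite /= ?pr ?(path0_drop pr) // /not_both0 c0.
rewrite filter_cat /= c0 perm_catC /= perm_cons perm_catC.
move: pw; rewrite sE /fill /= filter_cat; case: ifP => _; case: b => //=.
Qed.

Lemma words_state n bs w : size bs <= n -> w \in words n bs ->
  state (n - size bs).+1 (size bs) w.
Proof.
elim: bs w => [|b bs IH] w /= le_n; first by rewrite inE => /eqP->.
case/flattenP=> _ /mapP[v vw ->] wv.
rewrite subnSK //; apply: children_state wv; first by rewrite subn_gt0.
exact: IH (ltnW le_n) vw.
Qed.

Lemma repl_cat b c s T :
  repl b c (s ++ T) = map (cat^~ T) (repl b c s) ++ map (cat s) (repl b c T).
Proof.
elim: s => [|y s IH] /=; first by rewrite map_id.
rewrite IH !map_cat catA; congr (_ ++ _); last by rewrite -!map_comp.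
congr (_ ++ _); last by rewrite -!map_comp.
by case: (y == 0) => //; case: b {IH}.
Qed.

Lemma gaps_before_le c w : gaps_before c w <= (gaps w).-1.
Proof.
rewrite /gaps_before -!subn1 leq_sub2r //.
by rewrite -[X in _ <= gaps X](cat_take_drop (index c w) w) gaps_cat leq_addr.
Qed.

(** * The recursion for permutations *)

Section Words.

Variables (F : fieldType) (x : F).
Hypothesis x0 : x != 0%R.

Local Open Scope ring_scope.

Local Notation raise := (raise x).
Local Notation raise_if := (raise_if x).
Local Notation scale := (scale x).
Local Notation mom := (mom x).
Local Notation amp := (amp x).

(** The value of [th] on [U^(h-g) Y_j U^g e_0], with [g] of the [h] blocks on the left of [c]: the
    [j] next values of the run go to the left of [c], so [Y_j] sees only these blocks. *)
Definition word_weight j c th w : F :=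
  x ^+ tot_word w * mom j (gaps_before c w)
    (iter ((gaps w).-1 - gaps_before c w) raise th).

Lemma raise_ifE b th : raise_if b th = iter b raise th.
Proof. by case: b. Qed.

(** This is [mom_sum] read backwards; [T] only contributes [U^(gaps T)]. *)
Lemma children_mom j b c s T th :
    (0 < c)%N -> path not_both0 0 (s ++ T) -> above c (s ++ T) ->
  \sum_(w' <- children b c (0%N :: s)) word_weight j c th (w' ++ T)
  = x ^+ tot_word (0%N :: s ++ T)
    * mom j.+1 (gaps s) (iter (gaps T) raise (raise_if b th)).
Proof.
move=> c0 ps ac.
pose f t g h := x ^+ t * mom j g (iter (h - g) raise th).
rewrite [LHS](children_sum f b c0 ps ac) /f (mom_sum x0) gaps_cat mulrDr !mulr_sumr raise_ifE.
congr (_ + _); apply: eq_bigr => i _; rewrite exprD mulrA -!iterD; congr (_ * mom _ _ (iter _ _ _)).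
  by have := ltn_ord i; lia.
by have := ltn_ord i; lia.
Qed.

Lemma index_children_left b c d s T w' : (0 < c)%N -> d != c -> d != 0%N ->
    d \notin s -> w' \in children b c (0%N :: s) ->
  (index c (w' ++ T) < index d (w' ++ T))%N.
Proof.
move=> c0 dc d0 ds w'c.
have dput t : d \in put b c t = (d \in t).
  by rewrite /put inE (negPf dc); case: b {w'c}; rewrite ?inE ?(negPf d0).
have cput t : c \in put b c t by rewrite inE eqxx.
have [cw' dw'] : c \in w' /\ d \notin w'.
  move: w'c; rewrite inE => /orP[/eqP->|/mapP[u /replP[a [r [sE uE]]] ->]].
    by rewrite in_cons cput orbT in_cons dput negb_or d0.
  move: ds; rewrite sE mem_cat in_cons => /norP[da /norP[_ dr]].
  case: uE => ->; split.
  - by rewrite in_cons mem_cat cput !orbT.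
  - by rewrite in_cons mem_cat dput !negb_or d0 da.
  - by rewrite in_cons mem_cat in_cons cput !orbT.
  by rewrite in_cons mem_cat in_cons dput !negb_or d0 da.
by rewrite !index_cat cw' (negPf dw') ltn_addr ?index_mem.
Qed.

(** A constraint confines [c] to the gaps on the left of [c+1], and the run goes on. Otherwise [c]
    goes anywhere, and [Y_(j+1)] acts on all blocks. *)
Lemma words_amp n j bs fl th : size fl = size bs -> (size bs <= n)%N ->
  \sum_(w <- words n bs | before_ok (n - size bs).+1 fl w)
     word_weight j (n - size bs).+1 th w
  = amp j bs fl th.
Proof.
elim: bs fl j th => [|b bs IH] [|f fl] //= j th => [_ _|[sz] le_n].
  by rewrite big_seq1 /word_weight /gaps_before subn0 /= mom_j0 mul1r.
set c := (n - size bs)%N; rewrite subnSK // -/c.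
have c0 : (0 < c)%N by rewrite subn_gt0.
transitivity (\sum_(w <- words n bs | before_ok c.+1 fl w)
   if f then word_weight j.+1 c.+1 (raise_if b th) w
   else word_weight 0 c.+1 (scale j.+1 0 (raise_if b th)) w); last first.
  by case: f; rewrite -IH // ltnW.
rewrite big_flatten big_map [RHS]big_mkcond [LHS]big_seq [RHS]big_seq.
apply: eq_bigr => w ww; have st := words_state (ltnW le_n) ww.
have wE := state_cons st; move: (behead w) wE => s wE; subst w.
have aw := state_above st; case/and3P: (st) => _ /= ps _.
(* The remaining constraints compare only letters larger than [c]. *)
have ok w' : w' \in children b c (0%N :: s) ->
    before_ok c.+1 fl w' = before_ok c.+1 fl (0%N :: s).
  move=> /(childrenP _ _ _ ps)[a [r [-> ->]]].
  by rewrite -[LHS](@before_ok_filter _ c) // -[RHS](@before_ok_filter _ c) // fill_filter ?ltnn.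
transitivity (if before_ok c.+1 fl (0%N :: s) then
    \sum_(w' <- children b c (0%N :: s) | f ==> (index c w' < index c.+1 w')%N)
      word_weight j c th w' else 0).
  case ok0: (before_ok c.+1 fl (0%N :: s)); rewrite big_seq_cond.
    rewrite [RHS]big_seq_cond; apply: eq_bigl => w'.
    by case: (boolP (w' \in _)) => //= w'c; rewrite ok // ok0 andbT.
  by rewrite big1 // => w' /and3P[w'c _]; rewrite ok // ok0.
case: (before_ok c.+1 fl (0%N :: s)) => //.
have as_ : above c s by [].
case: f {ok}; last first.
  transitivity (\sum_(w' <- children b c (0%N :: s)) word_weight j c th (w' ++ [::])).
    by apply: eq_bigr => w' _; rewrite cats0.
  rewrite children_mom ?cats0 // /word_weight /mom; congr (_ * _).
  have := gaps_before_le c.+1 (0%N :: s); rewrite gaps_cons => le_g.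
  have e h : scale 0 0 (iter (gaps s - gaps_before c.+1 (0%N :: s)) raise
      (scale j.+1 0 (raise_if b th))) h
    = iter (gaps s - gaps_before c.+1 (0%N :: s)) raise (scale j.+1 0 (raise_if b th)) h.
    by rewrite /scale hsym0l mul1r.
  by rewrite (eq_iter_raise _ _ e) -iterD subnKC.
(* [T] starts at the letter [c+1], and is empty if that letter is absent. *)
set d := c.+1; set s1 := take (index d s) s; set T := drop (index d s) s.
have sE : s = s1 ++ T by rewrite cat_take_drop.
have ds1 : d \notin s1.
  by apply/negP => /index_ltn; rewrite ltnn.
rewrite {1}sE.
have -> : children b c (0%N :: s1 ++ T) = map (cat^~ T) (children b c (0%N :: s1))
     ++ map (cat (0%N :: s1)) (repl b c T).
  rewrite /children repl_cat map_cat -cat_cons; congr (_ ++ _); last by rewrite -map_comp.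
  by rewrite map_cons cat_cons put_cat -!map_comp.
(* Insertions inside [T] put [c] to the right of [c+1] and are excluded. *)
rewrite big_cat !big_map -[RHS]addr0; congr (_ + _); last first.
  apply: big1_seq.
  move=> u /andP[lt_cd uT].
  have cs1 : c \notin 0%N :: s1.
    rewrite inE negb_or -lt0n c0 /=; apply: contra (above_notin c0 as_).
    by rewrite sE mem_cat => ->.
  case TE: T uT lt_cd => [|y T'] //.
  have yd : y = d.
    case: (boolP (d \in s)) => [ds|]; last first.
      by rewrite -index_mem -leqNgt => /drop_oversize; rewrite -/T TE.
    by move: TE; rewrite /T (drop_nth 0%N) ?index_mem // nth_index // => -[].
  rewrite yd => /mapP[u' _ ->].
  by rewrite !index_cat (negPf cs1) inE (negPf ds1) /= eqxx addn0 ltnNge leq_addr.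
transitivity (\sum_(w' <- children b c (0%N :: s1)) word_weight j c th (w' ++ T)).
  rewrite big_seq_cond [RHS]big_seq; apply: eq_bigl => w'.
  case: (boolP (w' \in _)) => //= w'c.
  by rewrite (index_children_left _ c0 _ _ ds1 w'c) // gtn_eqF.
rewrite children_mom -?sE // /word_weight; congr (_ * _).
have -> : gaps_before d (0%N :: s) = gaps s1.
  by [].
have gT : (gaps s - gaps s1 = gaps T)%N by rewrite {1}sE gaps_cat addKn.
by rewrite gaps_cons add1n /= gT.
Qed.

End Words.

(** * [words] lists each partial permutation with a given descent mask exactly once *)

Definition descent_mask c m w : bitseq := [seq descent_at d w | d <- iota c m].

Lemma mask_children b c m w w' : 0 < c -> state c.+1 m w ->
  w' \in children b c w -> descent_mask c m.+1 w' = b :: descent_mask c.+1 m w.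
Proof.
move=> c0 st; have wE := state_cons st; move: (behead w) wE => s wE; subst w.
have aw := state_above st; case/and3P: st => _ /= ps _.
case/(childrenP _ _ _ ps) => a [r [-> sE]].
have [pa pr] := fill_path ps sE; have [aa ar] := fill_above sE aw.
rewrite /descent_mask /=; congr (_ :: _).
  rewrite -cat_cons descent_at_put // inE negb_or above_notin // andbT.
  by rewrite -lt0n.
apply/eq_in_map => d; rewrite mem_iota => /andP[lt_cd _].
by rewrite sE descent_at_fill // c0.
Qed.

Lemma words_mask n bs w : size bs <= n -> w \in words n bs ->
  descent_mask (n - size bs).+1 (size bs) w = bs.
Proof.
elim: bs w => [|b bs IH] w //= le_n.
case/flattenP=> _ /mapP[v vw ->] wv; rewrite subnSK //.
rewrite (mask_children _ _ wv) ?subn_gt0 ?IH //; first exact: ltnW.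
exact: words_state (ltnW le_n) vw.
Qed.

Lemma state0 c w : state c 0 w -> w = [:: 0].
Proof.
move=> st; have wE := state_cons st; move: (behead w) wE => s wE; subst w.
case/and3P: st => _; case: s => //= y s /andP[+ _] /perm_size.
by rewrite /not_both0 /= => ->.
Qed.

(** Erasing the smallest letter gives back a parent; the bit [b] tells whether a gap followed that
    letter. *)
Lemma words_complete n m w : m <= n -> state (n - m).+1 m w ->
  w \in words n (descent_mask (n - m).+1 m w).
Proof.
elim: m w => [|m IH] w le_n; first by move=> /state0 ->.
rewrite subnSK //; set c := n - m => st.
have c0 : 0 < c by rewrite subn_gt0.
have wE := state_cons st; move: (behead w) wE => s wE; subst w.
case/and3P: (st) => _; rewrite [behead _]/= => ps pw.
have cs : c \in s.
  have := perm_mem pw c; rewrite mem_filter mem_iota leqnn addnS ltnS leq_addr.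
  by rewrite inE (gtn_eqF c0) => /andP[].
have [a [v sE]] : exists a v, s = a ++ c :: v.
  by case/splitPr: cs => a v; exists a, v.
have [b [r [vE pr]]] : exists b r, c :: v = put b c r /\ path not_both0 0 r.
  move: ps; rewrite sE cat_path => /and3P[_ _].
  case: v {sE} => [|[|y] v] /=; first by exists false, [::].
    by case/andP=> _ pv; exists true, v.
  by case/andP=> _ pv; exists false, (y.+1 :: v).
rewrite vE in sE; set p := fill 0 a r.
have pa : path not_both0 0 a by move: ps; rewrite sE cat_path => /andP[].
have pp : path not_both0 0 (behead p).
  rewrite /p /fill /= cat_path pa /=; case: eqP => [->//|/eqP la] /=.
  by rewrite /not_both0 lt0n la.
have stp : state c.+1 m p.
  apply/and3P; split => //; move: pw; rewrite sE /= filter_cat /put /= c0 /=.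
  rewrite perm_catC /= perm_cons perm_catC; apply: etrans; congr perm_eq.
  by rewrite /p /fill /= filter_cat; case: ifP; case: (b).
have wp : 0 :: s \in children b c p.
  have pE : p = 0 :: behead p by [].
  by rewrite pE; apply/childrenP => //; exists a, r; rewrite sE.
rewrite (mask_children c0 stp wp) /=; apply/flattenP.
exists (children b c p) => //; apply/mapP; exists p; last by rewrite size_map size_iota.
exact: IH (ltnW le_n) stp.
Qed.

Lemma uniq_flatten_map (S T : eqType) (t : S -> seq T) (s : seq S) : uniq s ->
    {in s, forall y, uniq (t y)} ->
    {in s &, forall y z, forall u, u \in t y -> u \in t z -> y = z} ->
  uniq (flatten (map t s)).
Proof.
elim: s => //= y s IH /andP[ys us] ut inj; rewrite cat_uniq ut ?mem_head //=.
rewrite IH // ?andbT; last first.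
- by move=> a b ai bi; apply: inj; rewrite inE ?ai ?bi orbT.
- by move=> a ai; apply: ut; rewrite inE ai orbT.
apply/hasPn => u /flattenP[_ /mapP[z zs ->] uz]; apply/negP => uy.
by move: ys; rewrite (inj y z _ _ u) ?mem_head ?zs // inE zs orbT.
Qed.

Lemma repl_uniq b c s : 0 < c -> c \notin s -> path not_both0 c s -> uniq (repl b c s).
Proof.
move=> c0; have hd s' v : c \notin s' -> path not_both0 0 s' -> c :: v \notin repl b c s'.
  move=> cs' ps'; apply/negP => /replP[a [r [sE uE]]]; subst s'.
  case: a cs' ps' uE => [|y a] /=; first by case: r.
  by rewrite inE negb_or => /andP[/negPf yc _] _ [] [] cy _; rewrite cy eqxx in yc.
elim: s => //= y s IH; rewrite inE negb_or => /andP[cy cs] /andP[_ ps].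
have inj : injective (cons y) by move=> ? ? [].
have us : uniq (repl b c s).
  by apply: IH => //; case: s ps {cs} => //= z s /andP[_ ->]; rewrite /not_both0 c0.
case: eqP ps => y0 ps /=; last by rewrite map_inj_uniq.
subst y; rewrite map_inj_uniq // us andbT !inE negb_or.
rewrite /put eqseq_cons (gtn_eqF c0) /= (mem_map inj) hd // andbT.
by apply/mapP => -[? _ [c0']]; rewrite c0' in c0.
Qed.

(** The parts before and after [c] in a child are unique, and [fill] rebuilds the parent from
    them. *)
Lemma words_uniq n bs : size bs <= n -> uniq (words n bs).
Proof.
elim: bs => //= b bs IH le_n; set c := n - size bs.
have c0 : 0 < c by rewrite subn_gt0.
have st := words_state (ltnW le_n).
apply: uniq_flatten_map; first exact: IH (ltnW le_n).
  move=> w /st; rewrite -/c => sw; have wE := state_cons sw.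
  move: (behead w) wE => s wE; subst w.
  have := above_notin c0 (state_above sw); rewrite inE negb_or => /andP[_ cs].
  case/and3P: sw => _ /= ps _.
  have inj : injective (cons 0) by move=> ? ? [].
  rewrite map_inj_uniq // repl_uniq // ?andbT; last by rewrite (path0_drop ps).
  rewrite (mem_map inj); apply/negP => /replP[a [r [sE uE]]]; subst s.
  case: a cs ps uE => [|y a] /=; first by case: r.
  by rewrite inE negb_or => /andP[/negPf yc _] _ [] [] cy _; rewrite cy eqxx in yc.
move=> w1 w2 /st; rewrite -/c => s1 /st; rewrite -/c => s2 u.
have E1 := state_cons s1; move: (behead w1) E1 => t1 E1; subst w1.
have E2 := state_cons s2; move: (behead w2) E2 => t2 E2; subst w2.
have a1 := state_above s1; have a2 := state_above s2.
case/and3P: s1 => _ /= p1 _; case/and3P: s2 => _ /= p2 _.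
case/(childrenP _ _ _ p1) => b1 [r1 [uE F1]].
case/(childrenP _ _ _ p2) => b2 [r2 [uE' F2]].
have [/(above_notin c0) n1 _] := fill_above F1 a1.
have [/(above_notin c0) n2 _] := fill_above F2 a2.
have e : b1 ++ put b c r1 = b2 ++ put b c r2 by move: uE'; rewrite uE => -[].
have eb : b1 = b2.
  have := congr1 (fun v => take (index c v) v) e.
  by rewrite /put !index_cat (negPf n1) (negPf n2) /= eqxx !addn0 !take_size_cat.
have er : r1 = r2.
  move: e; rewrite eb => /eqP; rewrite eqseq_cat // eqxx /= => /eqP[].
  by case: (b) => -[].
by rewrite F1 F2 eb er.
Qed.

(** * Translation of the compositions into bit vectors *)

Lemma eqseq_map (T : Type) (S : eqType) (f g : T -> S) s :
  ([seq f i | i <- s] == [seq g i | i <- s]) = all (fun i => f i == g i) s.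
Proof. by elim: s => //= y s IH; rewrite eqseq_cons IH. Qed.

Lemma descent_setE n I : 0 < n -> is_composition n I ->
  descent_set I = [seq i <- iota 1 n.-1 | i \in descent_set I].
Proof. by move=> n0 cI; rewrite -{1}(composition_ofK n0 cI) descent_set_of. Qed.

Lemma composition_of_eq n D I : 0 < n -> is_composition n I ->
  (composition_of n D == I)
  = all (fun i => (i \in D) == (i \in descent_set I)) (iota 1 n.-1).
Proof.
move=> n0 cI; apply/eqP/allP => [<- i ii|DI].
  by rewrite descent_set_of // mem_filter ii andbT.
rewrite -[RHS](composition_ofK n0 cI) /composition_of.
by congr (pairmap _ _ (rcons _ _)); apply: eq_in_filter => i /DI /eqP.
Qed.

Lemma is_composition_rev n J : is_composition n (rev J) = is_composition n J.
Proof. by rewrite /is_composition all_rev sumn_rev. Qed.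

Lemma descent_set_rev n J i : is_composition n J ->
  i \in descent_set (rev J) -> n - i \in descent_set J.
Proof.
case/andP=> _ /eqP sJ /mapP[k]; rewrite mem_iota size_rev => /andP[k0].
case: (posnP (size J)) => [->|sz0]; first by case: k k0.
rewrite add1n prednK // => lt_k ->; rewrite take_rev sumn_rev.
apply/mapP; exists (size J - k); first by rewrite mem_iota subn_gt0 lt_k; lia.
by rewrite -sJ -{1}(cat_take_drop (size J - k) J) sumn_cat addnK.
Qed.

Lemma mem_descent_set_rev n J i : is_composition n J -> i <= n ->
  (i \in descent_set (rev J)) = (n - i \in descent_set J).
Proof.
move=> cJ le_in; apply/idP/idP; first exact: descent_set_rev.
have cJ' : is_composition n (rev J) by rewrite is_composition_rev.
by rewrite -{1}(revK J) => /(descent_set_rev cJ'); rewrite subKn.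
Qed.

Lemma mem_descent_set n I i : 0 < n -> is_composition n I ->
  i \in descent_set I -> 0 < i < n.
Proof.
move=> n0 cI; rewrite (descent_setE n0 cI) mem_filter => /andP[_].
by rewrite mem_iota add1n prednK.
Qed.

Lemma iota1_rcons m : iota 1 m.+1 = rcons (iota 1 m) m.+1.
Proof. by rewrite -cats1 -[in LHS](addn1 m) iotaD. Qed.

Lemma flip_false_mem n (S : seq nat) m r : m <= n ->
    0 < r <= count (fun y => y \notin S) (iota 1 m) ->
  flip_false r [seq y \in S | y <- rev (iota 1 m)]
  = [seq y \in letter [seq y <- iota 1 n | y \notin S] r :: S | y <- rev (iota 1 m)].
Proof.
elim: m => [|m IH] le_n; first by case: r.
have iS := iota1_rcons m.
rewrite iS rev_rcons /= -cats1 count_cat /= addn0 => /andP[r0 le_r].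
have cE : count negb [seq y \in S | y <- rev (iota 1 m)]
    = count (fun y => y \notin S) (iota 1 m) by rewrite count_map count_rev.
rewrite cE; case: (boolP (m.+1 \in S)) le_r => mS /=.
  by rewrite addn0 => le_r; rewrite IH ?(ltnW le_n) ?r0 // inE mS orbT.
set l := letter _ _; rewrite addn1 => le_r.
have lE : l = nth 0 ([seq y <- iota 1 m | y \notin S] ++ m.+1
    :: [seq y <- iota m.+2 (n - m.+1) | y \notin S]) r.-1.
  by rewrite /l /letter -(subnKC le_n) iotaD iS filter_cat filter_rcons mS cat_rcons addKn.
(* The element sought is [m+1] exactly when [r] exceeds the number of missing elements in
   [1, ..., m]. *)
case: eqP => [rE|/eqP rn].
  have -> : l = m.+1.
    by rewrite lE -rE nth_cat size_filter ltnn subnn.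
  rewrite inE eqxx; congr (_ :: _); apply/eq_in_map => y.
  by rewrite mem_rev mem_iota inE add1n => /andP[_ /ltn_eqF ->].
have {}le_r : r <= count (fun y => y \notin S) (iota 1 m).
  by move: le_r; rewrite leq_eqVlt eq_sym (negPf rn).
rewrite IH ?(ltnW le_n) ?r0 // inE (negPf mS) orbF; congr (_ :: _).
apply/esym/negbTE; rewrite lE nth_cat size_filter prednK // le_r.
have : nth 0 [seq y <- iota 1 m | y \notin S] r.-1 \in [seq y <- iota 1 m | y \notin S].
  by rewrite mem_nth // size_filter prednK.
by rewrite mem_filter mem_iota add1n => /and3P[_ _ /gtn_eqF ->].
Qed.

(** [S] stays inside [1, ..., m]: a letter [k <= m] that exceeds [|S|] asks for the [(k - |S|)]-th
    of the [m - |S|] elements missing there. *)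
Lemma lc_maskE n m u : m <= n -> u \in sub_seqs m ->
  let S := foldr (LC_step n) [::] u in
  [/\ lc_mask u = [seq y \in S | y <- rev (iota 1 m)], uniq S
    & {in S, forall y, 0 < y <= m}].
Proof.
elim: m u => [|m IH] u le_n; first by rewrite inE => /eqP->.
case/mem_sub_seqsS => v vm [k le_k ->].
rewrite [foldr _ _ _]/= [lc_mask _]/=.
have [mE uS Sm] := IH v (ltnW le_n) vm; set S := foldr _ _ v in mE uS Sm *.
have iS := iota1_rcons m.
have pS : perm_eq [seq y <- iota 1 m | y \in S] S.
  apply: uniq_perm; rewrite ?filter_uniq ?iota_uniq // => y.
  by rewrite mem_filter mem_iota add1n ltnS andbC; case: (boolP (y \in S)) => [/Sm->|]; rewrite ?andbF.
have cS : count id (lc_mask v) = size S.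
  by rewrite mE count_map count_rev -(perm_size pS) size_filter.
have cN : count (fun y => y \notin S) (iota 1 m) = m - size S.
  by rewrite -(perm_size pS) size_filter -{2}(size_iota 1 m) -(count_predC (mem S)) addKn.
rewrite /lc_mask_step cS /LC_step; case: (leqP k (size S)) => lt_k.
  split=> // [|y /Sm /andP[-> /leqW ->] //].
  rewrite iS rev_rcons /= mE; congr (_ :: _); apply/esym/negbTE/negP => /Sm.
  by rewrite ltnn andbF.
have r_ok : 0 < k - size S <= count (fun y => y \notin S) (iota 1 m).
  by rewrite subn_gt0 lt_k cN leq_sub2r.
set l := letter _ _.
have lm : l \in [seq y <- iota 1 m | y \notin S].
  rewrite /l /letter -(subnKC (ltnW le_n)) iotaD filter_cat nth_cat size_filter.
  case/andP: r_ok => r0 r_le; rewrite prednK // r_le.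
  by rewrite mem_nth // size_filter prednK.
move: (lm); rewrite mem_filter mem_iota add1n => /and3P[lS l0 l_m].
split.
- rewrite mE (flip_false_mem (ltnW le_n)) // iS rev_rcons /=; congr (_ :: _).
  rewrite inE (gtn_eqF l_m) /=; apply/esym/negbTE/negP => /Sm.
  by rewrite ltnn andbF.
- by rewrite /= lS.
by move=> y; rewrite inE => /orP[/eqP->|/Sm/andP[-> /leqW ->]//]; rewrite l0 ltnW.
Qed.

Lemma mask_maj_mem (S : seq nat) m :
  mask_maj [seq y \in S | y <- rev (iota 1 m)] = sumn [seq y <- iota 1 m | y \in S].
Proof.
elim: m => // m IH; rewrite iota1_rcons rev_rcons filter_rcons /= IH.
rewrite size_map size_rev size_iota.
by case: (m.+1 \in S); rewrite ?mul1n ?mul0n // -cats1 sumn_cat /= addn0 addnC.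
Qed.

(** Since [J] is mirrored and the list decreases, the entries also say whether [d - 1] is a descent
    of [J], for [d = 1, ..., n]: this one mask serves for both [LC] and [GC]. *)
Definition lc_pattern n J : bitseq := [seq y \in descent_set (rev J) | y <- rev (iota 1 n)].

Definition asc_pattern n I : bitseq := [seq i \notin descent_set I | i <- iota 1 n].

Lemma mask_maj_lc_pattern n J : 0 < n -> is_composition n J ->
  mask_maj (lc_pattern n J) = maj (rev J).
Proof.
move=> n0 cJ; have cJ' : is_composition n (rev J) by rewrite is_composition_rev.
rewrite mask_maj_mem /maj [in RHS](descent_setE n0 cJ').
case: n n0 cJ cJ' => // n _ _ cJ'; rewrite iota1_rcons filter_rcons.
by case: ifP => // /(mem_descent_set (ltn0Sn n) cJ'); rewrite ltnn andbF.
Qed.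

Lemma mem_sub_seqs m v :
  (v \in sub_seqs m) = (size v == m) && all (fun i => nth 0 v i <= m - i.+1) (iota 0 m).
Proof.
elim: m v => [|m IH] [|k v] //.
  by apply/mem_sub_seqsS => -[? _ [? _]].
have -> : (k :: v \in sub_seqs m.+1) = (v \in sub_seqs m) && (k <= m).
  apply/mem_sub_seqsS/andP => [[u um [k' km [-> ->]]]|[vm km]] //.
  by exists v => //; exists k.
rewrite IH /= subn1 eqSS andbAC -andbA; congr (_ && (_ && _)).
by rewrite -[1]/(1 + 0) iotaDl all_map.
Qed.

Lemma sub_seqs_uniq m : uniq (sub_seqs m).
Proof.
elim: m => // m IH; apply: allpairs_uniq => //; first exact: iota_uniq.
by move=> [u k] [u' k'] _ _ /= [-> ->].
Qed.

(* The last entry is [true] exactly when the last letter is [0]. *)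
Fixpoint asc_vec (u : seq nat) : bitseq :=
  if u is k :: u' then (k <= head 0 u') :: asc_vec u' else [::].

Lemma asc_vecE u : asc_vec u = [seq letter u i <= letter u i.+1 | i <- iota 1 (size u)].
Proof.
elim: u => //= k u ->; rewrite -nth0; congr (_ :: _).
rewrite [in RHS](iotaDl 1 1) -map_comp; apply/eq_in_map => i.
by rewrite mem_iota; case: i.
Qed.

Lemma asc_okE fl u : size fl = size u -> asc_ok fl u = all2 implb fl (asc_vec u).
Proof. by elim: fl u => [|f fl IH] [|k u] //= [/IH ->]. Qed.

Lemma all_iota1 (P : pred nat) n : 0 < n -> P n ->
  all P (iota 1 n) = all P (iota 1 n.-1).
Proof. by case: n => // n _ Pn; rewrite iota1_rcons all_rcons Pn. Qed.

Lemma LC_eq n (u : n.-tuple 'I_n) J : 0 < n -> is_composition n J ->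
    sf_word u \in sub_seqs n ->
  (LC u == J) = (lc_mask (sf_word u) == lc_pattern n J).
Proof.
move=> n0 cJ un; have cJ' : is_composition n (rev J) by rewrite is_composition_rev.
rewrite /LC -(inj_eq (can_inj revK)) revK composition_of_eq //.
have [mE _ _] := lc_maskE (leqnn n) un.
rewrite mE /lc_pattern eqseq_map all_rev (all_iota1 n0) // -/(LC_set u).
have -> : (n \in descent_set (rev J)) = false.
  by apply/negP => /(mem_descent_set n0 cJ'); rewrite ltnn andbF.
have := congr1 (head false) mE; case: n n0 u {cJ cJ' mE} un => // n _ u un.
by rewrite iota1_rcons rev_rcons /= => <-; case: (sf_word u) (sub_seqs_size un).
Qed.

Lemma DC_eq n (u : n.-tuple 'I_n) I : 0 < n -> is_composition n I ->
    sf_word u \in sub_seqs n ->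
  (DC u == I) = (asc_vec (sf_word u) == asc_pattern n I).
Proof.
move=> n0 cI; rewrite mem_sub_seqs => /andP[/eqP sz /allP ule].
rewrite /DC composition_of_eq // asc_vecE sz /asc_pattern eqseq_map (all_iota1 n0).
  apply: eq_in_all => i ii; rewrite mem_filter ii andbT ltnNge.
  by rewrite -[in RHS](inj_eq negb_inj) negbK.
have nI : (n \in descent_set I) = false.
  by apply/negP => /(mem_descent_set n0 cI); rewrite ltnn andbF.
have := ule n.-1; rewrite mem_iota add0n prednK // leqnn => /(_ isT).
by rewrite subnn leqn0 nI /letter => /eqP->.
Qed.

(** For the word of a permutation the last entry is [true], the index of the absent [n+1] being the
    length. *)
Definition pos_vec n (w : seq nat) : bitseq := [seq index i w < index i.+1 w | i <- iota 1 n].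

Lemma size_perm_word n (s : 'S_n) : size (perm_word s) = n.
Proof. by rewrite size_map size_enum_ord. Qed.

Lemma perm_word_uniq n (s : 'S_n) : uniq (perm_word s).
Proof. by rewrite map_inj_uniq ?enum_uniq // => i j [/val_inj/perm_inj]. Qed.

Lemma mem_perm_word n (s : 'S_n) i : (i \in perm_word s) = (0 < i <= n).
Proof.
apply/mapP/andP => [[j _ ->]|[i0 le_in]]; first by rewrite ltn_ord.
case: i i0 le_in => // i _ lt_in; exists ((s^-1)%g (Ordinal lt_in)); first by rewrite mem_enum.
by rewrite permKV.
Qed.

Lemma Rec_eq n (s : 'S_n) I : 0 < n -> is_composition n I ->
  (Rec s == I) = (pos_vec n (perm_word s) == asc_pattern n I).
Proof.
move=> n0 cI; rewrite composition_of_eq // /pos_vec /asc_pattern eqseq_map (all_iota1 n0).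
  apply: eq_in_all => i ii; rewrite /recoils mem_filter ii andbT.
  rewrite -[in RHS](inj_eq negb_inj) negbK -leqNgt [in RHS]leq_eqVlt.
  rewrite (_ : (index i.+1 _ == index i _) = false) //.
  apply/negP => /eqP eqi; have := mem_iota 1 n.-1 i; rewrite ii => /esym/andP[i0 i_n].
  have iw : i \in perm_word s by rewrite mem_perm_word i0 -ltnS (leq_trans i_n) // add1n prednK.
  have iw1 : i.+1 \in perm_word s by rewrite mem_perm_word /= -(prednK n0) -ltnS.
  have := congr1 (nth 0 (perm_word s)) eqi; rewrite !nth_index // => /eqP.
  by rewrite gtn_eqF.
have -> : (n \in descent_set I) = false.
  by apply/negP => /(mem_descent_set n0 cI); rewrite ltnn andbF.
have /memNindex -> : n.+1 \notin perm_word s by rewrite mem_perm_word ltnn.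
by rewrite index_mem mem_perm_word n0 leqnn.
Qed.

Lemma before_okE c fl w :
  before_ok c fl w = all2 implb fl [seq index i w < index i.+1 w | i <- iota c (size fl)].
Proof. by elim: fl c => //= f fl IH c; rewrite IH. Qed.

Lemma GC_eq n (s : 'S_n) J : 0 < n -> is_composition n J ->
  (GC s == J) = (descent_mask 1 n (0 :: perm_word s) == lc_pattern n J).
Proof.
move=> n0 cJ; set w := perm_word s; rewrite composition_of_eq //.
have -> : lc_pattern n J = [seq d.-1 \in descent_set J | d <- iota 1 n].
  rewrite /lc_pattern; apply: (@eq_from_nth _ false); first by rewrite !size_map size_rev.
  move=> i; rewrite size_map size_rev size_iota => lt_in.
  rewrite !(nth_map 0) ?size_rev ?size_iota // nth_rev ?size_iota //.
  have lt_ni : n - i.+1 < n by rewrite subnSK // leq_subr.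
  rewrite !nth_iota // add1n subnSK // (mem_descent_set_rev cJ) ?leq_subr //.
  by rewrite subKn // ltnW.
rewrite /descent_mask eqseq_map; case: n n0 s @w cJ => // n _ s w cJ.
rewrite [iota 1 n.+1]/= (iotaDl 1 1) /= all_map.
(* The value [1] is never a descent top, and [0] is in no descent set. *)
have -> : descent_at 1 (0 :: w) == (0 \in descent_set J).
  have -> : (0 \in descent_set J) = false by apply/negP => /(mem_descent_set (ltn0Sn n) cJ).
  rewrite descent_at_cons /= /descent_at.
  case: (ltnP (index 1 w).+1 (size w)) => h; last by rewrite nth_default.
  have := mem_nth 1 h; rewrite mem_perm_word => /andP[h0 _].
  by rewrite ltnNge h0.
rewrite /=; apply: eq_in_all => i; rewrite mem_iota => /andP[i0]; rewrite add1n => i_n /=.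
congr (_ == _); rewrite descent_at_cons /= add1n.
apply/mapP/idP => [[d dG iE]|h].
  have {iE}-> : i.+1 = d by rewrite iE prednK //; move: i0; rewrite iE; case: (d).
  case/mapP: dG => j; rewrite mem_filter mem_iota => /andP[lt_w /andP[j0 j_n]] ->.
  have lt_j : j.-1 < n.+1 by rewrite prednK // ltnW.
  rewrite /descent_at /letter index_uniq ?perm_word_uniq ?size_perm_word //.
  by rewrite prednK // (set_nth_default 0) ?size_perm_word.
exists i.+1 => //; apply/mapP; exists (index i.+1 w).+1.
  have lt_i : (index i.+1 w).+1 < size w.
    by rewrite ltnNge; apply/negP => /(nth_default i.+1) h'; move: h; rewrite /descent_at h' ltnn.
  rewrite mem_filter mem_iota /= /letter /= nth_index ?mem_perm_word //.
  by move: h lt_i; rewrite /descent_at size_perm_word => h lt_i; rewrite (set_nth_default i.+1) ?size_perm_word // h /=; lia.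
by rewrite /letter /= nth_index // mem_perm_word.
Qed.

(** * Patterns 31-2 and completed words *)

Lemma count_nth (P : pred nat) t : count P t = \sum_(k < size t) P (nth 0 t k).
Proof. by elim: t => [|y t IH] /=; rewrite ?big_ord0 // big_ord_recl /= IH. Qed.

Definition pattern_at w i j : bool :=
  [&& i.+1 < j, nth 0 w i.+1 < nth 0 w j & nth 0 w j < nth 0 w i].

Lemma tot_word_sum w :
  tot_word w = \sum_(i < size w) \sum_(j < size w) pattern_at w i j.
Proof.
elim: w => [|a w IH] /=; first by rewrite big_ord0.
rewrite big_ord_recl; transitivity ((if w is b :: t then count (fun y => b < y < a) t else 0)
  + tot_word w) => //.
congr (_ + _).
  rewrite big_ord_recl add0n; case: w {IH} => [|b t] /=; first by rewrite big_ord0.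
  by rewrite big_ord_recl add0n count_nth.
rewrite IH; apply: eq_bigr => i _; rewrite big_ord_recl add0n.
by apply: eq_bigr => j _; rewrite /pattern_at /= ltnS.
Qed.

Lemma tot_eq n (s : 'S_n) : tot s = tot_word (perm_word s).
Proof.
rewrite tot_word_sum size_perm_word /tot cardsE -sum1_card big_mkcond /=.
rewrite -(pair_bigA _ (fun i j : 'I_n.+1 => if [&& 0 < i, i.+1 < j,
   letter (perm_word s) i.+1 < letter (perm_word s) j
   & letter (perm_word s) j < letter (perm_word s) i] then 1 else 0)) /=.
rewrite big_ord_recl big1 ?add0n //; apply: eq_bigr => i _.
rewrite big_ord_recl /= add0n; apply: eq_bigr => j _.
by rewrite /pattern_at /letter /= ltnS; case: ifP.
Qed.

Lemma perm_word_surj n w : perm_eq w (iota 1 n) -> exists s : 'S_n, perm_word s = w.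
Proof.
case: n => [|n] pw.
  by exists 1%g; move/perm_size: pw; case: w => // _; apply/size0nil; rewrite size_perm_word.
have sz : size w = n.+1 by rewrite (perm_size pw) size_iota.
have bd i : i < n.+1 -> 0 < nth 0 w i <= n.+1.
  move=> lt_i; have := mem_nth 0 (etrans (congr1 (leq i.+1) sz) lt_i : i < size w).
  by rewrite (perm_mem pw) mem_iota add1n.
pose f (i : 'I_n.+1) : 'I_n.+1 := inord (nth 0 w i).-1.
have fE i : (f i).+1 = nth 0 w i.
  have /andP[w0 wn] := bd i (ltn_ord i).
  by rewrite inordK prednK.
have inj : injective f.
  move=> i j fij; apply/val_inj/eqP; rewrite -(@nth_uniq _ 0 w) ?sz ?ltn_ord ?(perm_uniq pw) ?iota_uniq //.
  by apply/eqP; rewrite -[LHS]fE -[RHS]fE fij.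
exists (perm inj); apply: (@eq_from_nth _ 0); first by rewrite size_perm_word.
move=> i; rewrite size_perm_word => lt_i; rewrite (nth_map ord0) ?size_enum_ord //.
by rewrite permE fE nth_enum_ord.
Qed.

Lemma perm_word_inj n : injective (@perm_word n).
Proof.
move=> s t /eq_in_map st; apply/permP => i.
by apply/val_inj; have [] := st i (mem_enum _ i).
Qed.

Lemma state_perm_word n (s : 'S_n) : state 1 n (0 :: perm_word s).
Proof.
have fE : [seq y <- perm_word s | 0 < y] = perm_word s.
  by apply/all_filterP/allP => y; rewrite mem_perm_word => /andP[].
apply/and3P; split=> //=; last first.
  rewrite fE; apply: uniq_perm; rewrite ?perm_word_uniq ?iota_uniq // => y.
  by rewrite mem_perm_word mem_iota add1n ltnS.
have : all (fun y => 0 < y) (perm_word s) by apply/all_filterP.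
have gen z t : all (fun y => 0 < y) t -> path not_both0 z t.
  by elim: t z => //= y t IH z /andP[y0 t0]; rewrite IH // /not_both0 y0 orbT.
exact: gen.
Qed.

(** When only the first gap is left, the rest of the word is a full permutation. *)
Lemma closed_words n bs : size bs = n ->
  perm_eq [seq w <- words n bs | (gaps w).-1 == 0]
    [seq 0 :: perm_word s | s <- index_enum {perm 'I_n} & descent_mask 1 n (0 :: perm_word s) == bs].
Proof.
move=> sz; have le_n : size bs <= n by rewrite sz.
apply: uniq_perm; first by rewrite filter_uniq // words_uniq.
  by rewrite map_inj_uniq ?filter_uniq ?index_enum_uniq // => s t [/perm_word_inj].
move=> w; rewrite mem_filter; apply/andP/mapP => [[g0 ww]|[s]].
  have := words_mask le_n ww; have := words_state le_n ww; rewrite sz subnn => st mw.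
  have wE := state_cons st; move: (behead w) wE => t wE; subst w.
  have tE : [seq y <- t | 0 < y] = t.
    apply/all_filterP/allP => y yt; rewrite lt0n; apply/negP => /eqP y0; subst y.
    by move: g0; rewrite gaps_cons add1n /= /gaps -leqn0 leqNgt -has_count has_pred1 yt.
  case/and3P: (st) => _ _; rewrite /= tE => /perm_word_surj[s sE].
  by exists s; rewrite ?sE // mem_filter mem_index_enum sE mw eqxx.
rewrite mem_filter => /andP[/eqP mE _] ->; split.
  rewrite gaps_cons add1n /= /gaps; apply/eqP/count_memPn.
  by rewrite mem_perm_word.
by rewrite -mE; have := words_complete (leqnn n); rewrite subnn => /(_ _ (state_perm_word s)).
Qed.

Section Final.

Local Open Scope ring_scope.

Variables (F : fieldType) (x : F).
Hypothesis x0 : x != 0.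

(** The coefficient of [e_0] in [e_h]: [vac] selects the completed words. *)
Lemma iter_raise_vac h : iter h (raise x) (vac x) 0%N = (h == 0%N)%:R.
Proof.
case: h => [|h]; first by rewrite /= /vac bin_small // expr0 invr1.
have e : raise x (vac x) =1 (fun=> 0) by move=> h'; apply: raise_vac.
rewrite iterSr (eq_iter_raise _ _ e).
suff: iter h (raise x) (fun=> 0) =1 (fun=> 0) by move->.
elim: h => //= h IH h'.
by rewrite (eq_raise _ IH) /raise mulr0 subr0.
Qed.

Lemma perm_sum n bs fl : size bs = n -> size fl = n ->
  \sum_(s : 'S_n | (descent_mask 1 n (0%N :: perm_word s) == bs)
                   && all2 implb fl (pos_vec n (perm_word s))) x ^+ tot s
  = amp x 0 bs fl (vac x).
Proof.
move=> szb szf; rewrite -(words_amp x0 (n := n)) ?szb // subnn.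
transitivity (\sum_(w <- [seq w <- words n bs | (gaps w).-1 == 0%N] | before_ok 1 fl w)
  x ^+ tot_word w).
  rewrite (perm_big _ (closed_words szb)) big_map big_filter_cond /=.
  apply: eq_big => s; last by rewrite tot_eq tot_word0.
  congr (_ && _); rewrite -[RHS](@before_ok_filter 1 0) //= before_ok_filter //.
  by rewrite before_okE szf.
rewrite big_filter_cond /= big_mkcondl; apply: eq_bigr => w _.
rewrite /word_weight mom_0g -iterD subnKC ?gaps_before_le // iter_raise_vac.
by case: eqP => _; rewrite ?mulr1 ?mulr0.
Qed.

End Final.

(** * Inclusion-exclusion *)

Section InclusionExclusion.

Local Open Scope ring_scope.

Variables (R : zmodType) (T1 T2 : Type) (r1 : seq T1) (r2 : seq T2).
Variables (v1 : T1 -> bitseq) (v2 : T2 -> bitseq) (f1 : T1 -> R) (f2 : T2 -> R).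
Variable m : nat.
Hypothesis sz1 : forall y, size (v1 y) = m.
Hypothesis sz2 : forall y, size (v2 y) = m.
Hypothesis upper_eq : forall fl, size fl = m ->
  \sum_(y <- r1 | all2 implb fl (v1 y)) f1 y = \sum_(y <- r2 | all2 implb fl (v2 y)) f2 y.

(** Interpolates between the condition of [upper_eq], for [ds] empty, and equality, for [fl]
    empty. *)
Let mixed fl ds (v : bitseq) :=
  all2 implb fl (take (size fl) v) && (drop (size fl) v == ds).

Lemma mixed_rcons fl ds b v : size v = (size fl + (size ds).+1)%N ->
  mixed (rcons fl b) ds v = mixed fl (true :: ds) v || ~~ b && mixed fl (false :: ds) v.
Proof.
move=> szv; have le_k : (size fl < size v)%N by rewrite szv addnS ltnS leq_addr.
rewrite -(cat_take_drop (size fl) v) (drop_nth false) //.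
have szt : size (take (size fl) v) = size fl by rewrite size_takel // ltnW.
move: (take _ v) (nth _ _ _) (drop _ v) szt => u c t szt.
have szr : size (rcons u c) = size (rcons fl b) by rewrite !size_rcons szt.
rewrite -cat_rcons [LHS]/mixed take_size_cat // drop_size_cat // cat_rcons.
rewrite /mixed take_size_cat // drop_size_cat // !eqseq_cons.
have -> : all2 implb (rcons fl b) (rcons u c) = all2 implb fl u && (b ==> c).
  by elim: fl u szt {le_k szv szr} => [|f fl IH] [|y u] //= => [|[/IH->]]; rewrite ?andbT ?andbA.
by case: (b); case: (c); case: (all2 _ _ _); case: (t == ds).
Qed.

Lemma mixed_eq fl ds : (size fl + size ds)%N = m ->
  \sum_(y <- r1 | mixed fl ds (v1 y)) f1 y = \sum_(y <- r2 | mixed fl ds (v2 y)) f2 y.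
Proof.
elim: ds fl => [|d ds IH] fl szm.
  have E v : size v = m -> mixed fl [::] v = all2 implb fl v.
    move=> szv; rewrite /mixed -size_eq0 size_drop szv -szm addn0 subnn andbT.
    by rewrite take_oversize // szv -szm addn0.
  under eq_bigl => y do rewrite E //; under [RHS]eq_bigl => y do rewrite E //.
  by apply: upper_eq; rewrite -szm addn0.
have szr b : (size (rcons fl b) + size ds)%N = m by rewrite size_rcons addSnnS.
have mT v : size v = m -> mixed fl (true :: ds) v = mixed (rcons fl true) ds v.
  by move=> szv; rewrite mixed_rcons ?orbF // szv.
case: d szm => szm.
  under eq_bigl => y do rewrite mT //; under [RHS]eq_bigl => y do rewrite mT //.
  exact: IH.
(* An exact [false] is the absence of condition minus an exact [true]. *)
have split_sum (T : Type) (r : seq T) (v : T -> bitseq) (f : T -> R) :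
    (forall y, size (v y) = m) ->
  \sum_(y <- r | mixed fl (false :: ds) (v y)) f y
  = \sum_(y <- r | mixed (rcons fl false) ds (v y)) f y
    - \sum_(y <- r | mixed (rcons fl true) ds (v y)) f y.
  move=> szv; rewrite big_mkcond [X in X - _]big_mkcond [X in _ - X]big_mkcond -sumrB.
  apply: eq_bigr => y _; rewrite -mT // mixed_rcons ?szv //=.
  have: ~~ (mixed fl (true :: ds) (v y) && mixed fl (false :: ds) (v y)).
    rewrite /mixed; case: (drop _ _) => [|[] t]; rewrite ?andbF // !eqseq_cons ?andbF //.
  by case: (mixed fl (true :: ds) _); case: (mixed fl (false :: ds) _);
    rewrite //= ?subrr ?subr0.
by rewrite !split_sum // !IH.
Qed.

Lemma exact_eq ds : size ds = m ->
  \sum_(y <- r1 | v1 y == ds) f1 y = \sum_(y <- r2 | v2 y == ds) f2 y.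
Proof.
move=> szd; have := @mixed_eq [::] ds szd.
have E v : mixed [::] ds v = (v == ds) by rewrite /mixed take0 drop0.
by under eq_bigl => y do rewrite E; under [RHS]eq_bigl => y do rewrite E.
Qed.

End InclusionExclusion.

(** * Subexcedent tuples and the identity *)

Local Open Scope ring_scope.

Lemma sf_words n : (0 < n)%N ->
  perm_eq [seq sf_word u | u <- index_enum {: n.-tuple 'I_n} & subexcedent u] (sub_seqs n).
Proof.
move=> n0; apply: uniq_perm; last 2 [exact: sub_seqs_uniq].
  rewrite map_inj_uniq ?filter_uniq ?index_enum_uniq // => u v uv.
  by apply/val_inj/(inj_map val_inj).
have subE (u : n.-tuple 'I_n) : subexcedent u = (sf_word u \in sub_seqs n).
  rewrite mem_sub_seqs size_map size_tuple eqxx /=.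
  apply/forallP/allP => [h i|h i].
    rewrite mem_iota add0n => /andP[_ lt_i]; have := h (Ordinal lt_i).
    by rewrite (tnth_nth (Ordinal n0)) (nth_map (Ordinal n0)) ?size_tuple.
  have := h i; rewrite mem_iota ltn_ord => /(_ isT).
  by rewrite (tnth_nth (Ordinal n0)) (nth_map (Ordinal n0)) ?size_tuple.
move=> v; apply/mapP/idP => [[u]|vn].
  by rewrite mem_filter subE => /andP[un _] ->.
case: n n0 vn subE => // n _ vn subE.
have szv : size (map (@inord n) v) == n.+1 by rewrite size_map (sub_seqs_size vn).
have vE : sf_word (Tuple szv) = v.
  rewrite /sf_word /= -map_comp -[RHS]map_id; apply/eq_in_map => k kv.
  rewrite /= inordK //; have := vn; rewrite mem_sub_seqs => /andP[_ /allP h].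
  have := h (index k v); rewrite mem_iota add0n /= -{1}(sub_seqs_size vn) index_mem kv.
  by rewrite nth_index // => /(_ isT); rewrite ltnS subSS => /leq_trans -> //; apply: leq_subr.
by exists (Tuple szv); rewrite ?vE // mem_filter subE vE vn mem_index_enum.
Qed.

Theorem theorem5p1 (n : nat) (hn : (1 <= n)%N) (I J : seq nat)
    (hI : is_composition n I) (hJ : is_composition n J) :
  (\sum_(u : n.-tuple 'I_n | [&& subexcedent u, DC u == I & LC u == J])
      q ^ ((inv_sf u)%:Z - (maj (rev J))%:Z)
   = \sum_(s : 'S_n | (Rec s == I) && (GC s == J)) q ^+ tot s)%R.
Proof.
have q0 : q != 0 by rewrite /q tofrac_eq0 polyX_eq0.
have subE (u : n.-tuple 'I_n) : subexcedent u -> sf_word u \in sub_seqs n.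
  move=> su; rewrite -(perm_mem (sf_words hn)); apply/mapP.
  by exists u; rewrite // mem_filter su mem_index_enum.
set bs := lc_pattern n J; set ds := asc_pattern n I.
have szbs : size bs = n by rewrite size_map size_rev size_iota.
(* The conditions on [LC] and [GC] are put into the summands; inclusion-exclusion concerns only [DC]
   and [Rec]. *)
pose f (u : n.-tuple 'I_n) := if subexcedent u && (lc_mask (sf_word u) == bs)
  then q ^ ((inv_sf u)%:Z - (maj (rev J))%:Z) else 0.
pose g (s : 'S_n) := if descent_mask 1 n (0%N :: perm_word s) == bs then q ^+ tot s else 0.
transitivity (\sum_(u : n.-tuple 'I_n | asc_vec (sf_word u) == ds) f u).
  rewrite big_mkcond [RHS]big_mkcond; apply: eq_bigr => u _; rewrite /f.
  case: (boolP (subexcedent u)) => [su|_]; last by case: ifP.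
  by rewrite (DC_eq hn hI (subE u su)) (LC_eq hn hJ (subE u su)) -/ds -/bs;
    case: (_ == ds); case: (_ == bs).
transitivity (\sum_(s : 'S_n | pos_vec n (perm_word s) == ds) g s); last first.
  rewrite big_mkcond [RHS]big_mkcond; apply: eq_bigr => s _; rewrite /g.
  by rewrite (Rec_eq _ hn hI) (GC_eq _ hn hJ); case: eqP; case: eqP.
apply: (@exact_eq _ _ _ _ _ _ _ _ _ n); last by rewrite size_map size_iota.
- by move=> u; rewrite asc_vecE size_map size_iota size_map size_tuple.
- by move=> s; rewrite size_map size_iota.
move=> fl szfl.
transitivity (amp q 0 bs fl (vac q)); last first.
  rewrite -(perm_sum q0 szbs szfl) big_mkcond [RHS]big_mkcond; apply: eq_bigr => s _.
  by rewrite /g; case: (_ == bs); case: (all2 _ _ _).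
have := sub_sumE q0 0 (etrans szfl (esym szbs)).
rewrite mask_maj_lc_pattern // => e.
(* The factor [q^maj] in [sub_sumE] is divided out, which is the shift of the exponents. *)
rewrite -[RHS](mulfK (expf_neq0 (maj (rev J)) q0)) -e.
rewrite /sub_sum szfl -(perm_big _ (sf_words hn)) /= big_map big_filter_cond mulr_suml.
rewrite big_mkcond [RHS]big_mkcond; apply: eq_bigr => u _; rewrite /f.
case: (boolP (subexcedent u)) => [su|_] /=; last by case: ifP.
rewrite asc_okE ?size_map ?size_tuple //; case: ifP => // _.
case: eqP => _; last by rewrite mulr0 mul0r.
by rewrite mulr1 expfzDr // -exprnN -exprnP.
Qed.
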